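(* Let $G=\mathbb{Z}_2\times Q_8$. (1) An odd integer is an integer group determinant for $G$ if and only if it is either congruent to $1$ modulo $16$, or congruent to $9$ modulo $16$ and of the form $$s_1s_2(\ell_1\ell_2)^2,\qquad s_1,s_2\equiv -3 \pmod 8,\quad \ell_1,\ell_2\equiv 3\pmod 4,$$ for some $s_1,s_2\in\mathbb{Z}$ and $\ell_1,\ell_2\in\mathbb{N}$ satisfying either $$s_1\equiv s_2 \pmod{16}\ \text{ and }\ \ell_1\equiv \ell_2\pmod 8,$$ or $$s_1\equiv s_2+8\pmod{16}\ \text{ and }\ \ell_1\equiv \ell_2+4\pmod 8.$$ (2) The even integer group determinants for $G$ are exactly the following integers: - $2^{18}m$ with $m\in\mathbb{Z}$; - $2^{17}(2m+1)p^2$ with $m\in\mathbb{Z}$ and $p$ a prime with $p\equiv 3\pmod 4$; - $2^{16}m$ with $m\in\mathbb{Z}$, $m\equiv 1,3$ or $5\pmod 8$; - those $2^{16}m$ with $m\equiv 7\pmod 8$ that are of the form $$2^{16}(8t-1)\ell^2,\qquad t\in\mathbb{Z},\ \ell\in\mathbb{N},\ \ell\equiv 1\pmod 4,\ \ell\ge 5,$$ or of the form $$2^{16}(8t+3)(8k-3),\qquad t,k\in\mathbb{Z}.$$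
   Context: $\mathbb{Z}_2$ is the cyclic group of order 2 and $Q_8=\langle A,B\mid A^4=1,\ B^2=A^2,\ AB=BA^{-1}\rangle$ is the quaternion group of order 8. $\mathbb{N}$ denotes the positive integers. For a finite group $G$ and integers $(a_g)_{g\in G}$, the group determinant of $\sum_{g\in G}a_g g\in\mathbb{Z}[G]$ is $\mathcal{D}_G\left(\sum_{g\in G}a_g g\right)=\det\left(a_{gh^{-1}}\right)_{g,h\in G}$, the determinant of the $|G|\times|G|$ matrix with rows and columns indexed by the elements of $G$ in the same order and $(g,h)$ entry $a_{gh^{-1}}$. The integer group determinants for $G$ are the integers of the form $\mathcal{D}_G(x)$ with $x\in\mathbb{Z}[G]$. *)

(* Defs.v *)
From mathcomp Require Import all_boot all_order all_algebra all_fingroup all_solvable.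

Set Implicit Arguments.
Unset Strict Implicit.
Unset Printing Implicit Defensive.

Import GRing.Theory.
Local Open Scope ring_scope.

(* The function a stands for the element \sum_g a_g g of Z[gT]. *)
Definition group_det (gT : finGroupType) (a : {ffun gT -> int}) : int :=
  \det (\matrix_(i < #|gT|, j < #|gT|) a (enum_val i * (enum_val j)^-1)%g).

Definition is_group_det (gT : finGroupType) (n : int) : Prop :=
  exists a : {ffun gT -> int}, n = group_det a.

(* 'Z_2 carries its additive group law, the product type the componentwise one.
   By Grp_quaternion, 'Q_8 has the presentation <x, y | x^4, y^2 = x^2,
   x^y = x^-1>, where x^y = y^-1 * x * y. *)
Definition Z2Q8 : finGroupType := ('Z_2 * 'Q_8)%type.

(* Main.v *)
(** The characters of the centre Z_2 x Z(Q_8) cut the group matrix into four 4 x 4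
    blocks, so the determinant is K(c) N(d)^2 K(c') N(d')^2.  Here K is the product of
    the four linear forms c0 +- c1 +- c2 +- c3 with an even number of minus signs, N is
    the sum of four squares, and c, d, c', d' range over the integer vectors with
    c = d = c' = d' mod 2 and c + d = c' + d' mod 4 in every coordinate.

    The number of odd coordinates of c separates the cases.  One or three odd coordinates
    give the odd values.  None or four give 2^16 m with 4 | m or m = 1 mod 4.  With two odd
    coordinates c0, c1, N(d) is 2 l where l mod 4 is fixed by (d2 + d3)/2 mod 2, which the
    congruences tie to c2 + c3 and c2' + c3' mod 4; this produces the remaining conditions.

    Conversely explicit families of c, c' realise every value once N(d) and N(d') can be
    prescribed, which Lagrange's theorem allows except for a factor p^2, p = 1 mod 8,
    which needs p = x^2 + y^2 + z^2 + w^2 with x odd, y = z = 2 and w = 0 mod 4.  Start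
    from a quaternion q = a + v of norm p with v = 0 mod 4; v is nonzero since p is not a
    square.  Conjugating q by quaternions g of norm 3 removes the factors 3 of v.  Once
    3 does not divide v, some g does not conjugate q to an integral quaternion, so
    g q = q' h with h <> +- g of norm 3, and q' = +- g h^-1 mod 4 has the required shape. *)

Require Import Defs.
From mathcomp Require Import all_boot all_order all_algebra all_fingroup all_solvable.
From mathcomp Require Import ring zify.

Set Implicit Arguments.
Unset Strict Implicit.
Unset Printing Implicit Defensive.

Import Order.TTheory GRing.Theory Num.Theory.
Local Open Scope ring_scope.

(** * The determinant of Z_2 x Q_8 *)

(** Rows and columns undergo the same permutation, so its sign enters twice and cancels; any
    convenient enumeration of the group may be used. *)
Lemma det_reindex (R : comNzRingType) (T : finType) (n : nat) (f : 'I_n -> T)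
    (B : T -> T -> R) :
  injective f -> #|T| = n ->
  \det (\matrix_(i < #|T|, j < #|T|) B (enum_val i) (enum_val j)) =
  \det (\matrix_(i < n, j < n) B (f i) (f j)).
Proof.
move=> f_inj cardT; move: f f_inj; rewrite -cardT => f f_inj.
have g_inj : injective (fun i => enum_rank (f i)).
  exact: inj_comp enum_rank_inj f_inj.
pose s := perm g_inj.
set M := (X in \det X = _).
have -> : \matrix_(i, j) B (f i) (f j) = row_perm s (col_perm s M).
  by apply/matrixP=> i j; rewrite !mxE !permE !enum_rankK.
rewrite row_permE col_permE !det_mulmx !det_perm odd_permV.
by rewrite mulrCA -signr_addb addbb mulr1.
Qed.

(* For a central involution z, this enumeration puts the group matrix in the block form
   [[P, Q], [Q, P]]. *)
Definition translate_pair (gT : finGroupType) n (z : gT) (e : 'I_n -> gT) (k : 'I_(n + n)) : gT :=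
  match split k with inl i => e i | inr i => (z * e i)%g end.

Lemma translate_pair_lshift (gT : finGroupType) n z (e : 'I_n -> gT) i :
  translate_pair z e (lshift n i) = e i.
Proof. by rewrite /translate_pair (unsplitK (inl _ i)). Qed.

Lemma translate_pair_rshift (gT : finGroupType) n z (e : 'I_n -> gT) i :
  translate_pair z e (rshift n i) = (z * e i)%g.
Proof. by rewrite /translate_pair (unsplitK (inr _ i)). Qed.

Lemma translate_pair_inj (gT : finGroupType) n z (e : 'I_n -> gT) :
  injective e -> (forall i j, z * e i != e j)%g -> injective (translate_pair z e).
Proof.
move=> e_inj ze i j; rewrite -[i]splitK -[j]splitK.
case: (split i) => i' /=; case: (split j) => j' /=;
  rewrite ?translate_pair_lshift ?translate_pair_rshift => eq_ij.
- by rewrite (e_inj _ _ eq_ij).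
- by case/eqP: (ze j' i').
- by case/eqP: (ze i' j').
- by rewrite (e_inj _ _ (mulgI _ _ _ eq_ij)).
Qed.

(** Conjugation by the unipotent block matrix [[1, 1], [0, 1]] gives a block lower triangular matrix
    with diagonal blocks P + Q and P - Q. *)
Lemma det_block_sym (R : comNzRingType) n (P Q : 'M[R]_n) :
  \det (block_mx P Q Q P) = \det (P + Q) * \det (P - Q).
Proof.
have -> : \det (block_mx P Q Q P) =
  \det (block_mx 1%:M 1%:M 0 1%:M *m block_mx P Q Q P *m block_mx 1%:M (- 1%:M) 0 1%:M).
  by rewrite !det_mulmx !det_ublock !det1 !mulr1 mul1r.
rewrite !mulmx_block !mul1mx !mul0mx !mulmx0 !mulmx1 !mulmxN !mulmx1 !add0r !addr0.
by rewrite (addrC Q P) addNr det_lblock (addrC (- Q)).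
Qed.

(** The list [e] may be a mere transversal of a subgroup; for a full enumeration this is the group
    determinant. *)
Definition coset_det {R : comNzRingType} {gT : finGroupType} {n} (A : gT -> R) (e : 'I_n -> gT) : R :=
  \det (\matrix_(i, j) A (e i * (e j)^-1)%g).

(** Since [z] is central and its own inverse, multiplying both arguments by [z] does not change an
    entry. The two factors belong to the characters z -> 1 and z -> -1. *)
Lemma det_translate_pair (R : comNzRingType) (gT : finGroupType) n (z : gT)
    (e : 'I_n -> gT) (A : gT -> R) :
  (forall g, commute z g) -> (z ^+ 2 = 1)%g ->
  coset_det A (translate_pair z e) =
  coset_det (fun g => A g + A (z * g)%g) e * coset_det (fun g => A g - A (z * g)%g) e.
Proof.
move=> zC z2; rewrite /coset_det.
have zV : (z^-1 = z)%g by apply/eqP; rewrite eq_invg_mul -expg2 z2.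
set P := \matrix_(i < n, j < n) A (e i * (e j)^-1)%g.
set Q := \matrix_(i < n, j < n) A (z * (e i * (e j)^-1))%g.
have -> : \matrix_(i, j) A (translate_pair z e i * (translate_pair z e j)^-1)%g = block_mx P Q Q P.
  apply/matrixP=> i j; rewrite -[i]splitK -[j]splitK.
  case: (split i) => i' /=; case: (split j) => j' /=;
    rewrite ?block_mxEul ?block_mxEur ?block_mxEdl ?block_mxEdr !mxE;
    rewrite ?translate_pair_lshift ?translate_pair_rshift ?invMg ?zV //; congr A.
  - by rewrite mulgA -zC.
  - by rewrite mulgA.
  - by rewrite mulgA -zC !mulgA -expg2 z2 mul1g.
rewrite det_block_sym; congr (_ * _); congr (\det _);
  by apply/matrixP=> i j; rewrite !mxE.
Qed.

(** The group determinant of the Klein four-group, factored over its four characters. *)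
Definition klein_det {R : comNzRingType} (c0 c1 c2 c3 : R) : R :=
  (c0 + c1 + c2 + c3) * (c0 + c1 - c2 - c3) *
  ((c0 - c1 + c2 - c3) * (c0 - c1 - c2 + c3)).

Definition norm4 {R : comNzRingType} (d0 d1 d2 d3 : R) : R :=
  d0 ^+ 2 + d1 ^+ 2 + d2 ^+ 2 + d3 ^+ 2.

(** Indices are in [nat] rather than in an ordinal type, so that they compute and [ring] sees a
    polynomial. *)
Definition det3_expr {R : comNzRingType} (m : nat -> nat -> R) : R :=
  m 0 0 * (m 1 1 * m 2 2 - m 1 2 * m 2 1)
  - m 1 0 * (m 0 1 * m 2 2 - m 0 2 * m 2 1)
  + m 2 0 * (m 0 1 * m 1 2 - m 0 2 * m 1 1).

Lemma det3E (R : comNzRingType) (M : 'M[R]_3) (m : nat -> nat -> R) :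
  (forall i j : 'I_3, M i j = m i j) -> \det M = det3_expr m.
Proof.
move=> Mm; rewrite (expand_det_col _ ord0) !big_ord_recl big_ord0 /cofactor.
rewrite !(expand_det_col _ ord0) !big_ord_recl !big_ord0 /cofactor !det_mx11 !mxE !Mm /=.
by rewrite /det3_expr /bump /=; ring.
Qed.

Lemma det4E (R : comNzRingType) (M : 'M[R]_4) (m : nat -> nat -> R) :
  (forall i j : 'I_4, M i j = m i j) ->
  \det M = m 0 0 * det3_expr (fun i j => m (bump 0 i) (bump 0 j))
          - m 1 0 * det3_expr (fun i j => m (bump 1 i) (bump 0 j))
          + m 2 0 * det3_expr (fun i j => m (bump 2 i) (bump 0 j))
          - m 3 0 * det3_expr (fun i j => m (bump 3 i) (bump 0 j)).
Proof.
move=> Mm; rewrite (expand_det_col _ ord0) !big_ord_recl big_ord0 /cofactor.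
rewrite !Mm /=.
have minorE k : \det (row' k (col' ord0 M)) = det3_expr (fun i j => m (bump k i) (bump 0 j)).
  by apply: det3E => i j; rewrite !mxE Mm.
by rewrite !minorE /= /bump /=; ring.
Qed.

(** * The quaternion group and its two kinds of 4 x 4 blocks *)

Lemma quaternion_generators :
  exists x y : 'Q_8, [/\ #[x] = 4, y \notin <[x]>, y ^+ 2 = x ^+ 2 & y * x = x ^+ 3 * y]%g.
Proof.
have [[x y] [_ _ ox /setDP[_ Xy]] [_ y2 xy]] :=
  @generators_quaternion _ [set: gsort 'Q_8]%G 3 isT (isog_refl _).
exists x, y; split=> //.
have x4 : (x ^+ 4 = 1)%g by apply/eqP; rewrite -order_dvdn ox.
have -> : (x ^+ 3 = x^-1)%g by apply/eqP; rewrite eq_sym eq_invg_mul -expgS x4.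
have {1}<- : (x^-1 ^ y = x)%g by rewrite conjVg xy invgK.
by rewrite conjgE mulKVg.
Qed.

Section QuaternionBlock.

Variables (gT : finGroupType) (x y : gT).
Hypotheses (x4 : (x ^+ 4 = 1)%g) (y2 : (y ^+ 2 = x ^+ 2)%g) (yx : (y * x = x ^+ 3 * y)%g).

(* A transversal of {1, x^2} in the order 1, x, y, x y. *)
Definition quarter (i : 'I_4) : gT := (x ^+ odd i * y ^+ i./2)%g.

(** Here [s] is the scalar by which x^2 acts. For s = 1 this is the group matrix of the Klein
    four-group; for s = -1 it is left multiplication by the quaternion b0 + b1 i + b2 j + b3 k,
    whose determinant is the squared norm. *)
Definition quarter_table (R : comNzRingType) (s b0 b1 b2 b3 : R) (i j : nat) : R :=
  nth 0 (nth [::] [:: [:: b0; s * b1; s * b2; s * b3];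
                      [:: b1; b0; s * b3; b2];
                      [:: b2; b3; b0; s * b1];
                      [:: b3; s * b2; b1; b0]] i) j.

Lemma quarter_div (R : comNzRingType) (B : gT -> R) (s : R) :
  (forall g, B (x ^+ 2 * g)%g = s * B g) ->
  forall i j : 'I_4, B (quarter i * (quarter j)^-1)%g =
    quarter_table s (B 1%g) (B x) (B y) (B (x * y)%g) i j.
Proof.
move=> Bs.
set z := (x ^+ 2)%g in Bs *.
have ass (u v w : gT) : (u * v = w -> forall g, u * (v * g) = w * g)%g.
  by move=> <- g; rewrite mulgA.
have xx : (x * x = z)%g by rewrite -expg2.
have yy : (y * y = z)%g by rewrite -expg2.
have zz : (z * z = 1)%g by rewrite -expgD.
have xz : (x * z = z * x)%g by rewrite -xx mulgA.
have yz : (y * z = z * y)%g by rewrite -yy mulgA.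
have yx' : (y * x = z * (x * y))%g by rewrite yx mulgA -expgSr.
clearbody z.
have rA (u v w : gT) : (u * v * w = u * (v * w))%g by rewrite mulgA.
(* Read from left to right, these rules bring every word to the normal form z^a x^b y^c; the [ass]
   variants act inside right-associated products. *)
pose red := (yx', xx, yy, zz, xz, yz, ass _ _ _ yx', ass _ _ _ xx, ass _ _ _ yy,
  ass _ _ _ zz, ass _ _ _ xz, ass _ _ _ yz, @mul1g gT, @mulg1 gT).
have xV : (x^-1 = z * x)%g by apply/eqP; rewrite eq_invg_mul -?mulgA !(rA, red).
have yV : (y^-1 = z * y)%g by apply/eqP; rewrite eq_invg_mul -?mulgA !(rA, red).
have xyV : ((x * y)^-1 = z * (x * y))%g.
  by apply/eqP; rewrite eq_invg_mul -?mulgA !(rA, red).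
case=> [[|[|[|[|//]]]] lti]; case=> [[|[|[|[|//]]]] ltj];
  rewrite /quarter /quarter_table /= ?expg0 ?expg1 ?mul1g ?mulg1 ?invg1 ?mulg1 ?mulgV ?mul1g //;
  rewrite ?xyV ?xV ?yV -?Bs //; congr B; by rewrite -?mulgA !(rA, red).
Qed.

Lemma det_quarter_even (R : comNzRingType) (B : gT -> R) :
  (forall g, B (x ^+ 2 * g)%g = B g) ->
  coset_det B quarter =
  klein_det (B 1%g) (B x) (B y) (B (x * y)%g).
Proof.
pose m := quarter_table 1 (B 1%g) (B x) (B y) (B (x * y)%g).
move=> Bz; rewrite /coset_det (det4E (m := m)); last first.
  by move=> i j; rewrite mxE; apply: quarter_div => g; rewrite mul1r.
by rewrite /m /det3_expr /quarter_table /klein_det /bump /=; ring.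
Qed.

Lemma det_quarter_odd (R : comNzRingType) (B : gT -> R) :
  (forall g, B (x ^+ 2 * g)%g = - B g) ->
  coset_det B quarter =
  norm4 (B 1%g) (B x) (B y) (B (x * y)%g) ^+ 2.
Proof.
pose m := quarter_table (- 1) (B 1%g) (B x) (B y) (B (x * y)%g).
move=> Bz; rewrite /coset_det (det4E (m := m)); last first.
  by move=> i j; rewrite mxE; apply: quarter_div => g; rewrite mulN1r.
by rewrite /m /det3_expr /quarter_table /norm4 /bump /=; ring.
Qed.

End QuaternionBlock.

Lemma ffun_interpolation (T : finType) (R : Type) n (f : 'I_n -> T) (v : 'I_n -> R) (r0 : R) :
  injective f -> exists a : {ffun T -> R}, forall k, a (f k) = v k.
Proof.
move=> f_inj; exists [ffun g => if [pick k | f k == g] is Some k then v k else r0] => k.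
rewrite ffunE; case: pickP => [j /eqP/f_inj -> // | /(_ k)].
by rewrite eqxx.
Qed.

(* p, q, r, s give the coefficients at the translates of 1, x, y, x y by 1, t, z and t z,
   where t generates Z_2 and z = x^2. *)
Lemma is_group_detP (n : int) :
  is_group_det Z2Q8 n <->
  exists p q r s : nat -> int,
    n = let K (c : nat -> int) := klein_det (c 0) (c 1) (c 2) (c 3) in
        let N (d : nat -> int) := norm4 (d 0) (d 1) (d 2) (d 3) in
        K (fun i => p i + q i + (r i + s i)) * N (fun i => p i + q i - (r i + s i)) ^+ 2 *
       (K (fun i => p i - q i + (r i - s i)) * N (fun i => p i - q i - (r i - s i)) ^+ 2).
Proof.
have [x [y [ox Xy y2 yx]]] := quaternion_generators.
pose t : Z2Q8 := (1%R, 1%g); pose X : Z2Q8 := (1%g, x); pose Y : Z2Q8 := (1%g, y).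
have X4 : (X ^+ 4 = 1)%g.
  have x4 : (x ^+ 4 = 1)%g by apply/eqP; rewrite -order_dvdn ox.
  by rewrite !expgS in x4 *; congr pair; rewrite //= ?mulg1.
have Y2 : (Y ^+ 2 = X ^+ 2)%g by rewrite !expg2 in y2 *; congr pair.
have YX : (Y * X = X ^+ 3 * Y)%g.
  by rewrite !expgS in yx *; congr pair; rewrite //= ?mulg1.
have tC g : commute t g.
  by case: g => g h; congr pair; rewrite /= ?mulg1 ?mul1g //; apply: Zp_mulgC.
have t2 : (t ^+ 2 = 1)%g by rewrite expg2; congr pair; rewrite /= ?mulg1 //; apply/eqP.
pose z := (X ^+ 2)%g.
have z2 : (z ^+ 2 = 1)%g by rewrite -expgM X4.
have zY : commute z Y by rewrite /z -Y2; apply: commuteX2 1 _.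
pose e := quarter X Y.
have x_neq (i j : nat) : (i < 4)%N -> (j < 4)%N -> (x ^+ i == x ^+ j)%g = (i == j).
  by move=> lti ltj; rewrite eq_expg_mod_order ox !modn_small.
have Xpow k : (X ^+ k = (1, x ^+ k))%g.
  elim: k => // k IH; rewrite !expgS IH; congr pair; by rewrite /= mulg1.
have Ypow k : (Y ^+ k = (1, y ^+ k))%g.
  elim: k => // k IH; rewrite !expgS IH; congr pair; by rewrite /= mulg1.
pose w (a b : nat) := (x ^+ a * y ^+ b)%g.
have w_inj a b a' b' : (a < 4)%N -> (a' < 4)%N -> (b < 2)%N -> (b' < 2)%N ->
   w a b = w a' b' -> a = a' /\ b = b'.
  rewrite /w => lta lta'; case: b => [|[|//]] _; case: b' => [|[|//]] _;
    rewrite ?expg0 ?expg1 ?mulg1 => /eqP.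
  - by rewrite x_neq // => /eqP.
  - move=> /eqP E; case/negP: Xy; have -> : y = ((x ^+ a')^-1 * x ^+ a)%g.
      by rewrite E mulKg.
    by rewrite groupM ?groupV ?mem_cycle.
  - move=> /eqP E; case/negP: Xy; have -> : y = ((x ^+ a)^-1 * x ^+ a')%g.
      by rewrite -E mulKg.
    by rewrite groupM ?groupV ?mem_cycle.
  - by rewrite (inj_eq (mulIg _)) x_neq // => /eqP.
have eE i : e i = (1%g, w (odd i) i./2).
  by rewrite /e /quarter Xpow Ypow; congr pair; rewrite /= mulg1.
have zeE i : (z * e i)%g = (1%g, w (2 + odd i)%N i./2).
  by rewrite eE /z Xpow; congr pair; rewrite /= ?mulg1 // /w mulgA expgD.
have half_lt (i : 'I_4) : (i./2 < 2)%N by case: i => [[|[|[|[|]]]]].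
have odd_lt (i : nat) : (odd i < 4)%N by case: (odd i).
have odd_lt2 (i : nat) : (2 + odd i < 4)%N by case: (odd i).
have e_inj : injective e.
  move=> i j; rewrite !eE => -[/w_inj[] // oi hi].
  by apply: val_inj; rewrite /= -[LHS]odd_double_half oi hi odd_double_half.
have e8_inj : injective (translate_pair z e).
  apply: translate_pair_inj => // i j; rewrite zeE eE; apply/eqP => -[/w_inj[] //].
  by case: (odd i); case: (odd j).
have te8 k : exists g, (t * translate_pair z e k)%g = (1%R, g) /\ translate_pair z e k = (1%g, g).
  rewrite -[k]splitK; case: (split k) => i /=.
    by rewrite translate_pair_lshift eE; eexists; split=> //; congr pair; rewrite /= ?mul1g ?mulg1.
  by rewrite translate_pair_rshift zeE; eexists; split=> //; congr pair; rewrite /= ?mul1g ?mulg1.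
pose f := translate_pair t (translate_pair z e).
have f_inj : injective f.
  apply: translate_pair_inj => // i j; have [g [-> _]] := te8 i; have [h [_ ->]] := te8 j.
  by apply/eqP => -[].
have cardT : #|Z2Q8| = (4 + 4 + (4 + 4))%N.
  by rewrite card_prod card_ord -cardsT (@card_quaternion 3).
have f_onto g : exists k, g = f k.
  have /codomP[k ->] : g \in codom f by apply: inj_card_onto; rewrite ?card_ord ?cardT.
  by exists k.
have ze i : commute z (e i).
  by apply: commuteM; apply: commuteX => //; apply: commute_sym; apply: commuteX.
have zC g : commute z g.
  have ze8 k : commute z (translate_pair z e k).
    rewrite -[k]splitK; case: (split k) => i /=;
      rewrite ?translate_pair_lshift ?translate_pair_rshift //.
    exact: commuteM.
  have [k ->] := f_onto g; rewrite -[k]splitK /f.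
  case: (split k) => i /=; rewrite ?translate_pair_lshift ?translate_pair_rshift //.
  by apply: commuteM => //; apply: commute_sym.
(* The matrix is split by t, then each factor by z: the z-even part yields K and the z-odd part
   yields N^2. *)
have detE (a : {ffun Z2Q8 -> int}) :
   let K (c : Z2Q8 -> int) := klein_det (c 1%g) (c X) (c Y) (c (X * Y)%g) in
   let N (d : Z2Q8 -> int) := norm4 (d 1%g) (d X) (d Y) (d (X * Y)%g) in
   group_det a =
   K (fun g => a g + a (t * g)%g + (a (z * g)%g + a (t * (z * g))%g)) *
   N (fun g => a g + a (t * g)%g - (a (z * g)%g + a (t * (z * g))%g)) ^+ 2 *
   (K (fun g => a g - a (t * g)%g + (a (z * g)%g - a (t * (z * g))%g)) *
   N (fun g => a g - a (t * g)%g - (a (z * g)%g - a (t * (z * g))%g)) ^+ 2).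
  move=> K N; rewrite /group_det.
  rewrite (det_reindex (fun g h => a (g * h^-1)%g) f_inj cardT).
  rewrite -/(coset_det a f) (det_translate_pair _ _ tC t2) !(det_translate_pair _ _ zC z2).
  have zzg g : (z * (z * g) = g)%g by rewrite mulgA -expg2 z2 mul1g.
  rewrite [X in X * _ * _](det_quarter_even X4 Y2 YX); last by move=> g; rewrite -/z zzg; ring.
  rewrite [X in _ * X * _](det_quarter_odd X4 Y2 YX); last by move=> g; rewrite -/z zzg; ring.
  rewrite [X in _ * (X * _)](det_quarter_even X4 Y2 YX); last by move=> g; rewrite -/z zzg; ring.
  by rewrite [X in _ * (_ * X)](det_quarter_odd X4 Y2 YX) // => g; rewrite -/z zzg; ring.
pose c (i : nat) : Z2Q8 := nth 1%g [:: 1%g; X; Y; X * Y]%g i.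
split=> [[a ->] | [p [q [r [s ->]]]]].
  exists (fun i => a (c i)), (fun i => a (t * c i)%g), (fun i => a (z * c i)%g),
    (fun i => a (t * (z * c i))%g).
  by rewrite detE.
pose v8 (u v : nat -> int) (k : 'I_(4 + 4)) := match split k with inl i => u i | inr i => v i end.
pose v k := match split k with inl k => v8 p r k | inr k => v8 q s k end.
have [a av] := ffun_interpolation v 0 f_inj; exists a.
have av' (i : 'I_4) : [/\ a (e i) = p i, a (t * e i)%g = q i, a (z * e i)%g = r i
    & a (t * (z * e i))%g = s i].
  rewrite -(translate_pair_rshift z) -[e i](translate_pair_lshift z).
  rewrite -!(translate_pair_rshift t) -!(translate_pair_lshift t (translate_pair z e)) !av /v.
  rewrite !(unsplitK (inl _ _)) !(unsplitK (inr _ _)) /v8.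
  by rewrite !(unsplitK (inl _ _)) !(unsplitK (inr _ _)).
have ce i (lti : (i < 4)%N) : [/\ a (c i) = p i, a (t * c i)%g = q i, a (z * c i)%g = r i
    & a (t * (z * c i))%g = s i].
  have -> : c i = e (Ordinal lti); last exact: av'.
  by case: i lti => [|[|[|[|]]]] //= lti; rewrite /e /quarter /= ?expg0 ?expg1 ?mul1g ?mulg1.
rewrite detE /=.
have [-> -> -> ->] := ce 0%N isT; have [-> -> -> ->] := ce 1%N isT.
by have [-> -> -> ->] := ce 2%N isT; have [-> -> -> ->] := ce 3%N isT.
Qed.

(** * Sums of four squares *)

Lemma norm4_eq0 (a b c d : int) : norm4 a b c d = 0 -> [/\ a = 0, b = 0, c = 0 & d = 0].
Proof.
move=> /eqP; rewrite /norm4 !paddr_eq0 ?addr_ge0 ?sqr_ge0 // !sqrf_eq0.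
by case/andP=> /andP[/andP[]] /eqP -> /eqP -> /eqP -> /eqP ->.
Qed.

Lemma norm4_ge0 (a b c d : int) : 0 <= norm4 a b c d.
Proof. by rewrite /norm4 !addr_ge0 ?sqr_ge0. Qed.

Definition sum4 (n : int) : Prop := exists a b c d : int, n = norm4 a b c d.

(** Euler's identity: the witnesses are the coordinates of q' times the conjugate of q, and the
    quaternion norm is multiplicative. *)
Lemma sum4M m n : sum4 m -> sum4 n -> sum4 (m * n).
Proof.
move=> [a [b [c [d ->]]]] [a' [b' [c' [d' ->]]]].
exists (a * a' + b * b' + c * c' + d * d'), (a * b' - b * a' + c * d' - d * c'),
  (a * c' - c * a' + d * b' - b * d'), (a * d' - d * a' + b * c' - c * b').
by rewrite /norm4; ring.
Qed.

(** Equal squares force p to divide i - j or i + j, and both are smaller than p in absolute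
    value. *)
Lemma sqr_Fp_inj p k (i j : 'I_k) : prime p -> (2 * k <= p.+1)%N ->
  (i%:R ^+ 2 = j%:R ^+ 2 :> 'F_p) -> i = j.
Proof.
move=> p_pr ltkp /eqP; wlog leij: i j / (i <= j)%N.
  by move=> W E; case: (leqP i j) => [|/ltnW] le; [| apply/esym]; apply: W; rewrite // eq_sym.
rewrite eq_sym -subr_eq0 subr_sqr -natrB // -natrD mulf_eq0.
rewrite -!(dvdn_pcharf (pchar_Fp p_pr)) => /orP[/dvdnP[q]|/dvdnP[q]] E; apply: val_inj => /=;
  case: i j E leij => i lti [j ltj] /= E leij; case: q E => [|q]; nia.
Qed.

(** Pigeonhole: i^2 and -1 - j^2 each take (p + 1)/2 values in F_p, so they meet. The bounds on i
    and j make the cofactor of p smaller than p. *)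
Lemma prime_dvd_sqrD1 p : prime p -> odd p ->
  exists i j : nat, [/\ (2 * i < p)%N, (2 * j < p)%N & (p %| i ^ 2 + j ^ 2 + 1)%N].
Proof.
move=> p_pr p_odd; pose k := p.+1./2.
have pk : p = (2 * k).-1 by rewrite /k; lia.
have k_gt0 : (0 < k)%N by rewrite /k; have := prime_gt0 p_pr; lia.
pose f (i : 'I_k) : 'F_p := i%:R ^+ 2; pose g (i : 'I_k) : 'F_p := -1 - i%:R ^+ 2.
have f_inj : injective f by move=> i j /sqr_Fp_inj; apply => //; lia.
have g_inj : injective g by move=> i j /addrI/oppr_inj/sqr_Fp_inj; apply => //; lia.
have [dis|/pred0Pn[_ /andP[/= /codomP[i ->] /codomP[j fg]]]] :=
  boolP [disjoint codom f & codom g]%B; last first.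
  exists i, j; split; [have := ltn_ord i; lia | have := ltn_ord j; lia |].
  rewrite (dvdn_pcharf (pchar_Fp p_pr)) !natrD !natrX; move: fg; rewrite /f /g => ->.
  by rewrite addrNK addNr.
have := cardUI (mem (codom f)) (mem (codom g)); rewrite (eqP dis).
have := max_card [predU mem (codom f) & mem (codom g)].
rewrite card_Fp // !card_codom // card_ord addn0 => + eq_k; rewrite eq_k => le_kp; exfalso; lia.
Qed.

Lemma centered_residue (m : nat) (a : int) : (0 < m)%N ->
  exists r s : int, a = r + m%:Z * s /\ (2 * r) ^+ 2 <= m%:Z ^+ 2.
Proof.
move=> m_gt0; have E := divz_eq a m.
have ge0 : 0 <= (a %% m)%Z by apply: modz_ge0; lia.
have lt_m : (a %% m)%Z < m by apply: ltz_pmod; lia.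
have [le|lt] := leP (2 * (a %% m)%Z) m.
  by exists (a %% m)%Z, (a %/ m)%Z; split; [lia | nia].
by exists ((a %% m)%Z - m%:Z), ((a %/ m)%Z + 1); split; [lia | nia].
Qed.

Lemma sum4_eq_max (A B C D M : int) : A <= M -> B <= M -> C <= M -> D <= M ->
  A + B + C + D = 4 * M -> [/\ A = M, B = M, C = M & D = M].
Proof. by move=> *; split; lia. Qed.

(** Lagrange's descent: centered residues modulo m have norm m r with r <= m. Multiplying the two
    representations by Euler's identity gives coordinates divisible by m, hence a representation of
    p r. *)
Lemma sum4_descent (p m : nat) : prime p -> (0 < m < p)%N ->
  sum4 (p%:Z * m%:Z) -> sum4 p.
Proof.
move=> p_pr; elim/ltn_ind: m => m IH /andP[m_gt0 m_ltp] [a [b [c [d E]]]].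
have [m1|m_gt1] := eqVneq m 1%N.
  by exists a, b, c, d; rewrite -E m1 mulr1.
have not_dvd (t : int) : p%:Z <> m%:Z * t.
  move=> pmt; have : (m %| p)%N.
    by apply/dvdnP; exists `|t|%N; have := congr1 absz pmt; rewrite abszM /= mulnC.
  by move=> /(prime_nt_dvdP p_pr m_gt1) mp; move: m_ltp; rewrite mp ltnn.
have [a' [sa [aE ha]]] := centered_residue a m_gt0.
have [b' [sb [bE hb]]] := centered_residue b m_gt0.
have [c' [sc [cE hc]]] := centered_residue c m_gt0.
have [d' [sd [dE hd]]] := centered_residue d m_gt0.
have m_neq0 : m%:Z != 0 by lia.
have [r Er] : exists r, norm4 a' b' c' d' = m%:Z * r.
  exists (p%:Z - 2 * (a' * sa + b' * sb + c' * sc + d' * sd) - m%:Z * norm4 sa sb sc sd).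
  by rewrite !mulrBr (mulrC _ p%:Z) E /norm4 aE bE cE dE; ring.
have Er4 : (2 * a') ^+ 2 + (2 * b') ^+ 2 + (2 * c') ^+ 2 + (2 * d') ^+ 2 = 4 * (m%:Z * r).
  by rewrite -Er /norm4; ring.
have r_le : r <= m.
  rewrite -(@ler_pM2l _ (4 * m%:Z)); last by lia.
  rewrite -mulrA -Er4 (_ : 4 * m%:Z * m = m%:Z ^+ 2 + m%:Z ^+ 2 + m%:Z ^+ 2 + m%:Z ^+ 2).
    by rewrite !lerD.
  by ring.
have r_neq0 : r != 0.
  apply/eqP => r0; apply: (not_dvd (norm4 sa sb sc sd)); apply: (mulfI m_neq0).
  rewrite mulrC E; move: Er; rewrite r0 mulr0 => z.
  have [a0 b0 c0 d0] := norm4_eq0 z.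
  by rewrite /norm4 aE bE cE dE a0 b0 c0 d0; ring.
(* Equality would force every centered residue to be m/2 up to sign, and expanding the squares would
   make p a multiple of m. *)
have r_neqm : r != m.
  apply/eqP => rm; rewrite rm /norm4 in Er.
  have half x : (2 * x) ^+ 2 = m%:Z ^+ 2 -> exists e : int, 2 * x = e * m%:Z.
    by move/eqP; rewrite eqf_sqr => /orP[] /eqP ->; [exists 1 | exists (-1)]; rewrite ?mul1r ?mulN1r.
  have [|/half[ea Ea] /half[eb Eb] /half[ec Ec] /half[ed Ed]] := sum4_eq_max ha hb hc hd.
    by rewrite Er4 rm; ring.
  apply: (not_dvd (1 + (ea * sa + eb * sb + ec * sc + ed * sd) + norm4 sa sb sc sd)).
  apply: (mulfI m_neq0); rewrite mulrC E /norm4 aE bE cE dE.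
  transitivity (a' ^+ 2 + b' ^+ 2 + c' ^+ 2 + d' ^+ 2
     + m%:Z * (2 * a' * sa + 2 * b' * sb + 2 * c' * sc + 2 * d' * sd)
     + m%:Z ^+ 2 * norm4 sa sb sc sd); rewrite /norm4; first by ring.
  by rewrite Er Ea Eb Ec Ed; ring.
have r_ge0 : 0 <= r.
  rewrite -(@ler_pM2l _ m%:Z) ?mulr0 -?Er ?/norm4; last by lia.
  by rewrite !addr_ge0 ?sqr_ge0.
apply: (IH `|r|%N).
- by move: r_le r_ge0 r_neqm; clear; lia.
- by move: r_le r_ge0 r_neq0 r_neqm m_ltp; clear; lia.
(* These are the coordinates of Euler's identity for (a, b, c, d) and its residues, divided by m. *)
exists (r + (sa * a' + sb * b' + sc * c' + sd * d')),
  (sa * b' - sb * a' + sc * d' - sd * c'),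
  (sa * c' - sc * a' + sd * b' - sb * d'), (sa * d' - sd * a' + sb * c' - sc * b').
rewrite gez0_abs //; apply: (mulfI m_neq0); apply: (mulfI m_neq0).
transitivity ((p%:Z * m%:Z) * (m%:Z * r)); first by ring.
transitivity (norm4 (m%:Z * r + m%:Z * (sa * a' + sb * b' + sc * c' + sd * d'))
   (m%:Z * (sa * b' - sb * a' + sc * d' - sd * c'))
   (m%:Z * (sa * c' - sc * a' + sd * b' - sb * d'))
   (m%:Z * (sa * d' - sd * a' + sb * c' - sc * b'))); last by rewrite /norm4; ring.
by rewrite E -Er /norm4 aE bE cE dE; ring.
Qed.

Lemma sum4_prime p : prime p -> sum4 p.
Proof.
move=> p_pr; have [->|p_odd] := even_prime p_pr; first by exists 1, 1, 0, 0.
have [i [j [lti ltj /dvdnP[m E]]]] := prime_dvd_sqrD1 p_pr p_odd.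
apply: (@sum4_descent p m p_pr); first by have := prime_gt1 p_pr; clear p_pr p_odd; nia.
by exists i%:Z, j%:Z, 1, 0; rewrite /norm4; lia.
Qed.

Theorem sum4_nat (n : nat) : sum4 n.
Proof.
elim/ltn_ind: n => n IH; have [n_le1|n_gt1] := leqP n 1.
  by exists n%:Z, 0, 0, 0; case: n n_le1 {IH} => [|[|]].
rewrite -(divnK (pdiv_dvd n)) PoszM.
by apply: sum4M; [apply/IH/ltn_Pdiv; rewrite ?prime_gt1 ?pdiv_prime; lia | exact/sum4_prime/pdiv_prime].
Qed.

(** * Parities and the representation of determinants *)

(* The lattice c = d = c' = d' mod 2, c + d = c' + d' mod 4 of the values of the four
   characters of the centre on a quadruple of integer coefficients. *)
Definition compat (c d c' d' : int) : Prop :=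
  exists i j k : int, [/\ d = c + 2 * i, c' = c + 2 * j & d' = c + 2 * i + 2 * j + 4 * k].

Lemma compatP (c d c' d' : int) :
  (2 %| d - c)%Z -> (2 %| c' - c)%Z -> (4 %| c + d - (c' + d'))%Z -> compat c d c' d'.
Proof.
move=> /dvdzP[i Ei] /dvdzP[j Ej] /dvdzP[k Ek].
exists i, j, (- j - k); split; lia.
Qed.

(* ((c, d), (c', d')) *)
Definition coord : Type := (int * int * (int * int))%type.

Definition compat_coord (u : coord) := compat u.1.1 u.1.2 u.2.1 u.2.2.

Definition coord_det (u v w t : coord) : int :=
  klein_det u.1.1 v.1.1 w.1.1 t.1.1 * norm4 u.1.2 v.1.2 w.1.2 t.1.2 ^+ 2 *
  (klein_det u.2.1 v.2.1 w.2.1 t.2.1 * norm4 u.2.2 v.2.2 w.2.2 t.2.2 ^+ 2).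

Definition det_rep (n : int) : Prop :=
  exists u v w t : coord,
    [/\ compat_coord u, compat_coord v, compat_coord w & compat_coord t] /\
    n = coord_det u v w t.

(** The parameters of [compat] are i = - (r + s), j = - (q + s), k = s; solving these for p, q, r, s
    gives the witnesses of the converse. *)
Lemma det_repP n : is_group_det Z2Q8 n <-> det_rep n.
Proof.
rewrite is_group_detP /det_rep; split=> [[p [q [r [s ->]]]]|].
  pose u i : coord := ((p i + q i + (r i + s i), p i + q i - (r i + s i)),
                       (p i - q i + (r i - s i), p i - q i - (r i - s i))).
  have cu i : compat_coord (u i).
    by exists (- (r i + s i)), (- (q i + s i)), (s i); split; rewrite /=; ring.
  by exists (u 0%N), (u 1%N), (u 2%N), (u 3%N).
case=> -[[c0 d0] [c0' d0']] [[[c1 d1] [c1' d1']]] [[[c2 d2] [c2' d2']]] [[[c3 d3] [c3' d3']]].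
rewrite /compat_coord /coord_det /= => -[].
move=> [[i0 [j0 [k0 [-> -> ->]]]] [i1 [j1 [k1 [-> -> ->]]]]
        [i2 [j2 [k2 [-> -> ->]]]] [i3 [j3 [k3 [-> -> ->]]]]] ->.
pose sel (x0 x1 x2 x3 : int) (i : nat) := nth 0 [:: x0; x1; x2; x3] i.
exists (sel (c0 + i0 + j0 + k0) (c1 + i1 + j1 + k1) (c2 + i2 + j2 + k2) (c3 + i3 + j3 + k3)),
  (sel (- j0 - k0) (- j1 - k1) (- j2 - k2) (- j3 - k3)),
  (sel (- i0 - k0) (- i1 - k1) (- i2 - k2) (- i3 - k3)), (sel k0 k1 k2 k3).
rewrite /sel /=; congr (_ * _ ^+ 2 * (_ * _ ^+ 2)); rewrite /klein_det /norm4; ring.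
Qed.

(** * Parity and sorting of the coordinates *)

Definition oddz (x : int) : bool := ~~ (2 %| x)%Z.

Lemma oddzP (x : int) : oddz x -> exists f, x = 2 * f + 1.
Proof. by rewrite /oddz => ox; exists (x %/ 2)%Z; lia. Qed.

Lemma evenzP (x : int) : ~~ oddz x -> exists f, x = 2 * f.
Proof. by rewrite /oddz negbK => /dvdzP[f ->]; exists f; rewrite mulrC. Qed.

Lemma consecutive_even (x : int) : exists t, x * (x + 1) = 2 * t.
Proof.
have [/oddzP[f ->]|/evenzP[f ->]] := boolP (oddz x).
  by exists ((2 * f + 1) * (f + 1)); ring.
by exists (f * (2 * f + 1)); ring.
Qed.

Lemma sqrz_mod2 (x : int) : exists t, x ^+ 2 = x + 2 * t.
Proof.
have [t Et] := consecutive_even x; exists (t - x).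
by rewrite mulrBr -Et; ring.
Qed.

Lemma sqr_oddz (f : int) : exists g, (2 * f + 1) ^+ 2 = 1 + 8 * g.
Proof.
have [g Eg] := consecutive_even f; exists g.
have -> : 1 + 8 * g = 1 + 4 * (2 * g) by ring.
by rewrite -Eg; ring.
Qed.

Lemma sqr_even_mod8 (x : int) : exists t, (2 * x) ^+ 2 = 4 * x + 8 * t.
Proof. by have [t E] := sqrz_mod2 x; exists t; rewrite exprMn E; ring. Qed.

(** Adjacent transpositions generate all permutations. The determinant is symmetric in its four
    coordinates, so only five parity patterns remain out of sixteen. *)
Lemma sort4 (T : Type) (o : pred T) (P : T -> T -> T -> T -> Prop) :
  (forall x y z t, P x y z t -> P y x z t) -> (forall x y z t, P x y z t -> P x z y t) ->
  (forall x y z t, P x y z t -> P x y t z) ->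
  forall x y z t, P x y z t -> exists x' y' z' t',
    P x' y' z' t' /\ [/\ o y' -> o x', o z' -> o y' & o t' -> o z'].
Proof.
move=> s01 s12 s23 x y z t p.
have [ox|/negP ox] := boolP (o x); have [oy|/negP oy] := boolP (o y);
  have [oz|/negP oz] := boolP (o z); have [ot|/negP ot] := boolP (o t);
  first [ by exists x, y, z, t
  | by exists y, x, z, t; split; [auto|] | by exists x, z, y, t; split; [auto|]
  | by exists x, y, t, z; split; [auto|] | by exists z, x, y, t; split; [auto|]
  | by exists x, t, y, z; split; [auto|] | by exists y, x, t, z; split; [auto|]
  | by exists t, x, y, z; split; [auto|] | by exists y, z, x, t; split; [auto|]
  | by exists y, t, x, z; split; [auto|] | by exists y, z, t, x; split; [auto|]
  | by exists z, t, x, y; split; [auto|] ].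
Qed.

Lemma det_rep_sorted n : det_rep n -> exists u v w t : coord,
  ([/\ compat_coord u, compat_coord v, compat_coord w & compat_coord t] /\
   n = coord_det u v w t) /\
  [/\ oddz v.1.1 -> oddz u.1.1, oddz w.1.1 -> oddz v.1.1 & oddz t.1.1 -> oddz w.1.1].
Proof.
move=> [u [v [w [t rep]]]].
by apply: (@sort4 _ (fun u : coord => oddz u.1.1) (fun u v w t =>
    [/\ compat_coord u, compat_coord v, compat_coord w & compat_coord t] /\
    n = coord_det u v w t)) rep => {}u {}v {}w {}t [[? ? ? ?] ->]; split=> //;
  rewrite /coord_det /klein_det /norm4; ring.
Qed.

Lemma addz_odd_even (x y : int) : 2 * x + 1 + 2 * y = 2 * (x + y) + 1. Proof. by ring. Qed.
Lemma addz_odd_mul4 (x y : int) : 2 * x + 1 + 4 * y = 2 * (x + 2 * y) + 1. Proof. by ring. Qed.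
Lemma addz_even_even (x y : int) : 2 * x + 2 * y = 2 * (x + y). Proof. by ring. Qed.
Lemma addz_even_mul4 (x y : int) : 2 * x + 4 * y = 2 * (x + 2 * y). Proof. by ring. Qed.
Definition halvingE := (addz_odd_even, addz_odd_mul4, addz_even_even, addz_even_mul4).

(** * The values listed in the theorem, odd and even *)

Definition odd_form (n : int) : Prop :=
        (n = 1 %[mod 16])%Z \/
        ((n = 9 %[mod 16])%Z /\
         exists (s1 s2 : int) (l1 l2 : nat),
           [/\ (0 < l1)%N /\ (0 < l2)%N,
               (s1 = -3 %[mod 8])%Z /\ (s2 = -3 %[mod 8])%Z,
               (l1 = 3 %[mod 4])%N /\ (l2 = 3 %[mod 4])%N,
               ((s1 = s2 %[mod 16])%Z /\ (l1 = l2 %[mod 8])%N) \/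
               ((s1 = s2 + 8 %[mod 16])%Z /\ (l1 = l2 + 4 %[mod 8])%N)
             & n = s1 * s2 * (l1%:Z * l2%:Z) ^+ 2]).

Definition even_form (n : int) : Prop :=
     [\/ exists m : int, n = 2 ^+ 18 * m,
         exists (m : int) (p : nat),
           [/\ prime p, (p = 3 %[mod 4])%N
             & n = 2 ^+ 17 * (2 * m + 1) * p%:Z ^+ 2],
         exists m : int,
           [\/ (m = 1 %[mod 8])%Z, (m = 3 %[mod 8])%Z | (m = 5 %[mod 8])%Z]
           /\ n = 2 ^+ 16 * m
       | exists m : int,
           [/\ (m = 7 %[mod 8])%Z, n = 2 ^+ 16 * m
             & (exists (t : int) (l : nat),
                  [/\ (0 < l)%N, (l = 1 %[mod 4])%N, (5 <= l)%N
                    & n = 2 ^+ 16 * (8 * t - 1) * l%:Z ^+ 2])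
               \/ (exists t k : int,
                     n = 2 ^+ 16 * (8 * t + 3) * (8 * k - 3))]].

(** * Odd determinants *)

(** Only squares and 8 times a product occur, so the residues follow from those of squares. *)
Lemma klein_detE (c0 c1 c2 c3 : int) : klein_det c0 c1 c2 c3 =
  (c0 ^+ 2) ^+ 2 + (c1 ^+ 2) ^+ 2 + (c2 ^+ 2) ^+ 2 + (c3 ^+ 2) ^+ 2
  - 2 * (c0 ^+ 2 * c1 ^+ 2 + c0 ^+ 2 * c2 ^+ 2 + c0 ^+ 2 * c3 ^+ 2
         + c1 ^+ 2 * c2 ^+ 2 + c1 ^+ 2 * c3 ^+ 2 + c2 ^+ 2 * c3 ^+ 2)
  + 8 * (c0 * c1 * c2 * c3).
Proof. by rewrite /klein_det; ring. Qed.

Lemma klein_det_one_odd (f0 f1 f2 f3 : int) :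
  exists E, klein_det (2 * f0 + 1) (2 * f1) (2 * f2) (2 * f3) = 1 + 8 * (f1 + f2 + f3) + 16 * E.
Proof.
have [g0 E0] := sqr_oddz f0; have [g1 E1] := sqrz_mod2 f1.
have [g2 E2] := sqrz_mod2 f2; have [g3 E3] := sqrz_mod2 f3.
rewrite klein_detE E0 !exprMn E1 E2 E3.
set F1 := f1 + 2 * g1; set F2 := f2 + 2 * g2; set F3 := f3 + 2 * g3.
exists (g0 + 4 * g0 ^+ 2 - (f1 + f2 + f3) - (g1 + g2 + g3) - 4 * g0 * (F1 + F2 + F3)
  + (F1 ^+ 2 + F2 ^+ 2 + F3 ^+ 2) - 2 * (F1 * F2 + F1 * F3 + F2 * F3)
  + 4 * (2 * f0 + 1) * f1 * f2 * f3).
by rewrite /F1 /F2 /F3; ring.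
Qed.

Lemma norm4_one_odd (e0 e1 e2 e3 : int) :
  exists E, norm4 (2 * e0 + 1) (2 * e1) (2 * e2) (2 * e3) = 1 + 4 * (e1 + e2 + e3) + 8 * E.
Proof.
have [g0 E0] := sqr_oddz e0; have [g1 E1] := sqrz_mod2 e1.
have [g2 E2] := sqrz_mod2 e2; have [g3 E3] := sqrz_mod2 e3.
by rewrite /norm4 E0 !exprMn E1 E2 E3; exists (g0 + g1 + g2 + g3); ring.
Qed.

Lemma one_odd_factor (F I A C : int) :
  exists E, (1 + 8 * F + 16 * A) * (1 + 4 * I + 8 * C) ^+ 2 = 1 + 8 * (F + I) + 16 * E.
Proof.
pose X := I ^+ 2 + 4 * C ^+ 2 + C + 4 * I * C.
exists (A + X + 4 * F * I + 8 * F * X + 8 * A * I + 16 * A * X).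
by rewrite /X; ring.
Qed.

(** Each half K N^2 is 1 + 8 P modulo 16, and the congruences give P the parity of i1 + i2 + i3 plus
    an even number in both halves; the product is therefore 1 modulo 16. *)
Lemma coord_det_one_odd u v w t :
  compat_coord u -> compat_coord v -> compat_coord w -> compat_coord t ->
  oddz u.1.1 -> ~~ oddz v.1.1 -> ~~ oddz w.1.1 -> ~~ oddz t.1.1 ->
  exists m, coord_det u v w t = 1 + 16 * m.
Proof.
case: u v w t => -[c0 d0] [c0' d0'] [[c1 d1] [c1' d1']] [[c2 d2] [c2' d2']] [[c3 d3] [c3' d3']].
rewrite /compat_coord /coord_det /=.
move=> [i0 [j0 [k0 [-> -> ->]]]] [i1 [j1 [k1 [-> -> ->]]]].
move=> [i2 [j2 [k2 [-> -> ->]]]] [i3 [j3 [k3 [-> -> ->]]]].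
move=> /oddzP[f0 ->] /evenzP[f1 ->] /evenzP[f2 ->] /evenzP[f3 ->].
have [A EA] := klein_det_one_odd f0 f1 f2 f3.
have [B EB] := klein_det_one_odd (f0 + j0) (f1 + j1) (f2 + j2) (f3 + j3).
have [C EC] := norm4_one_odd (f0 + i0) (f1 + i1) (f2 + i2) (f3 + i3).
have [D ED] := norm4_one_odd (f0 + i0 + j0 + 2 * k0) (f1 + i1 + j1 + 2 * k1)
  (f2 + i2 + j2 + 2 * k2) (f3 + i3 + j3 + 2 * k3).
rewrite !halvingE EA EB EC ED.
have [Y ->] := one_odd_factor (f1 + f2 + f3) (f1 + i1 + (f2 + i2) + (f3 + i3)) A C.
set P := (f1 + f2 + f3 + _); set F' := _ + (f2 + j2) + _; set I' := _ + _ + (_ + 2 * k3).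
have [Z ->] := one_odd_factor F' I' B D.
have PQ : F' + I' = 2 * (2 * (f1 + f2 + f3) + j1 + j2 + j3 + i1 + i2 + i3 + k1 + k2 + k3) - P.
  by rewrite /F' /I' /P; ring.
rewrite PQ; set R := (2 * (f1 + f2 + f3) + _ + _ + _ + _ + _ + _ + _ + _ + _).
exists (R + Y + Z + 4 * P * (2 * R - P) + 8 * P * Z + 8 * (2 * R - P) * Y + 16 * Y * Z).
by ring.
Qed.

Lemma klein_det_three_odd (f0 f1 f2 f3 : int) :
  exists E, klein_det (2 * f0 + 1) (2 * f1 + 1) (2 * f2 + 1) (2 * f3) = - 3 + 8 * E.
Proof.
have [g0 E0] := sqr_oddz f0; have [g1 E1] := sqr_oddz f1; have [g2 E2] := sqr_oddz f2.
rewrite klein_detE E0 E1 E2 !exprMn; set F := f3 ^+ 2.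
exists (2 * (g0 + g1 + g2) + 8 * (g0 ^+ 2 + g1 ^+ 2 + g2 ^+ 2) + 2 * F ^+ 2
  - 4 * (g0 + g1 + g2) - 16 * (g0 * g1 + g0 * g2 + g1 * g2)
  - F * (3 + 8 * (g0 + g1 + g2))
  + (2 * f0 + 1) * (2 * f1 + 1) * (2 * f2 + 1) * (2 * f3)).
by ring.
Qed.

Lemma norm4_three_odd (f0 f1 f2 f3 : int) :
  exists E, norm4 (2 * f0 + 1) (2 * f1 + 1) (2 * f2 + 1) (2 * f3) = 3 + 4 * E.
Proof.
have [g0 E0] := sqr_oddz f0; have [g1 E1] := sqr_oddz f1; have [g2 E2] := sqr_oddz f2.
by rewrite /norm4 E0 E1 E2; exists (2 * (g0 + g1 + g2) + f3 ^+ 2); ring.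
Qed.

Lemma three_odd_mod16 (a b u v : int) :
  exists E, (- 3 + 8 * a) * (- 3 + 8 * b) * ((3 + 4 * u) * (3 + 4 * v)) ^+ 2 =
    9 + 8 * (a + b + u + v) + 16 * E.
Proof.
pose A := a + b; pose w := u + v; pose t := u * v.
pose X := 4 * a * b - 2 * A.
pose Y := 5 + 9 * w ^+ 2 + 16 * t ^+ 2 + 13 * w + 18 * t + 24 * w * t.
exists (4 * w + 4 * A * w + 9 * Y + 8 * A * Y + X * (1 + 8 * w + 16 * Y)).
by rewrite /X /Y /A /w /t; ring.
Qed.

(** With s = -3 + 8 a, -3 + 8 b and l = 3 + 4 p, 3 + 4 q, the parity of a + b compares s1 with s2
    modulo 16 and that of p + q compares l1 with l2 modulo 8. The value is 9 modulo 16 exactly when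
    these parities agree. *)
Lemma odd_form_three_odd u v w t :
  compat_coord u -> compat_coord v -> compat_coord w -> compat_coord t ->
  oddz u.1.1 -> oddz v.1.1 -> oddz w.1.1 -> ~~ oddz t.1.1 ->
  oddz (coord_det u v w t) /\ odd_form (coord_det u v w t).
Proof.
case: u v w t => -[c0 d0] [c0' d0'] [[c1 d1] [c1' d1']] [[c2 d2] [c2' d2']] [[c3 d3] [c3' d3']].
rewrite /compat_coord /coord_det /=.
move=> [i0 [j0 [k0 [-> -> ->]]]] [i1 [j1 [k1 [-> -> ->]]]].
move=> [i2 [j2 [k2 [-> -> ->]]]] [i3 [j3 [k3 [-> -> ->]]]].
move=> /oddzP[f0 ->] /oddzP[f1 ->] /oddzP[f2 ->] /evenzP[f3 ->].
rewrite !halvingE.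
have [a ->] := klein_det_three_odd f0 f1 f2 f3.
have [b ->] := klein_det_three_odd (f0 + j0) (f1 + j1) (f2 + j2) (f3 + j3).
have := norm4_three_odd (f0 + i0) (f1 + i1) (f2 + i2) (f3 + i3).
have := norm4_ge0 (2 * (f0 + i0) + 1) (2 * (f1 + i1) + 1) (2 * (f2 + i2) + 1) (2 * (f3 + i3)).
case: (norm4 _ _ _ _) => // l1 _ [p El1].
set X0 := f0 + i0 + j0 + _; set X1 := f1 + i1 + j1 + _; set X2 := f2 + i2 + j2 + _.
set X3 := f3 + i3 + j3 + _.
have := norm4_three_odd X0 X1 X2 X3.
have := norm4_ge0 (2 * X0 + 1) (2 * X1 + 1) (2 * X2 + 1) (2 * X3).
case: (norm4 _ _ _ _) => // l2 _ [q El2].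
have [E] := three_odd_mod16 a b p q; rewrite -El1 -El2.
have -> : (- 3 + 8 * a) * l1%:Z ^+ 2 * ((- 3 + 8 * b) * l2%:Z ^+ 2) =
  (- 3 + 8 * a) * (- 3 + 8 * b) * (l1%:Z * l2%:Z) ^+ 2 by ring.
set n := _ * _ * (l1%:Z * l2%:Z) ^+ 2 => En; split; first by rewrite /oddz En; lia.
have [/oddzP[S ES]|/evenzP[S ES]] := boolP (oddz (a + b + p + q)).
  by left; rewrite En ES; lia.
right; split; first by rewrite En ES; lia.
exists (- 3 + 8 * a), (- 3 + 8 * b), l1, l2.
split=> //; clear En n X0 X1 X2 X3; [split; lia | split; lia | split; lia |].
have [/oddzP[A EA]|/evenzP[A EA]] := boolP (oddz (a + b)); [right | left]; split; lia.
Qed.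

(** * Even determinants *)

Lemma even_form_mul4 (t : int) : even_form (2 ^+ 16 * (4 * t)).
Proof. by constructor 1; exists t; ring. Qed.

Lemma even_form_1mod4 (t : int) : even_form (2 ^+ 16 * (4 * t + 1)).
Proof.
constructor 3; exists (4 * t + 1); split=> //.
by have [/oddzP[f ->]|/evenzP[f ->]] := boolP (oddz t); [constructor 3 | constructor 1]; lia.
Qed.

Lemma oddzM x y : oddz (x * y) = oddz x && oddz y.
Proof.
have [/oddzP[f ->]|/evenzP[f ->]] := boolP (oddz x); have [/oddzP[g ->]|/evenzP[g ->]] := boolP (oddz y);
 rewrite /oddz.
- by rewrite (_ : _ * _ = 2 * (2 * f * g + f + g) + 1); [lia | ring].
- by rewrite (_ : _ * _ = 2 * ((2 * f + 1) * g)); [lia | ring].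
- by rewrite -mulrA; lia.
- by rewrite -mulrA; lia.
Qed.

Lemma mul_mod4 (x y : int) : oddz x -> oddz y -> exists t, x * y = x + y - 1 + 4 * t.
Proof. by move=> /oddzP[f ->] /oddzP[g ->]; exists (f * g); ring. Qed.

(** For odd x and y, x y = x + y - 1 modulo 4, so the product depends only on the sums: (2 s - 1)(2
    r - 1) = 1 + 2 (s + r) modulo 4. *)
Lemma four_linear (x y z w s r : int) : x + y = 2 * s -> z + w = 2 * r -> oddz x = oddz z ->
  (exists t, x * y * (z * w) = 16 * t) \/
  (oddz x /\ exists t, x * y * (z * w) = 1 + 2 * (s + r) + 4 * t).
Proof.
move=> xy zw xz; have oy : oddz y = oddz x by rewrite /oddz; lia.
have ow : oddz w = oddz x by rewrite xz /oddz; lia.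
have [ox|ex] := boolP (oddz x); [right; split=> // | left].
  have [|t1 ->] := @mul_mod4 x y ox; first by rewrite oy.
  have [||t2 ->] := @mul_mod4 z w; rewrite ?ow -?xz // xy zw.
  exists (s * r - s - r + (2 * s - 1) * t2 + (2 * r - 1) * t1 + 4 * t1 * t2); ring.
have [f ->] := evenzP ex; have [|g ->] := @evenzP y; first by rewrite oy.
have [|h ->] := @evenzP z; first by rewrite -xz.
have [|k ->] := @evenzP w; first by rewrite ow.
by exists (f * g * (h * k)); ring.
Qed.

Lemma klein_det_mod4 (c0 c1 c2 c3 : int) :
  (exists t, klein_det c0 c1 c2 c3 = 4 * t) \/ (exists t, klein_det c0 c1 c2 c3 = 1 + 4 * t).
Proof.
rewrite /klein_det.
have [|||[t ->]|[_ [t ->]]] := @four_linear (c0 + c1 + c2 + c3) (c0 + c1 - c2 - c3)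
  (c0 - c1 + c2 - c3) (c0 - c1 - c2 + c3) (c0 + c1) (c0 - c1); try ring.
- by rewrite /oddz; lia.
- by left; exists (4 * t); ring.
- by right; exists (c0 + t); ring.
Qed.

(** All four linear forms are even. Their halves have s + r = 2 f0 + 1, whence the residue 3; a
    product of two such k is 0 or 1 modulo 4. *)
Lemma klein_det_all_odd (f0 f1 f2 f3 : int) : exists2 k,
  klein_det (2 * f0 + 1) (2 * f1 + 1) (2 * f2 + 1) (2 * f3 + 1) = 16 * k &
  (exists t, k = 4 * t) \/ (exists t, k = 3 + 4 * t).
Proof.
exists ((f0 + f1 + f2 + f3 + 2) * (f0 + f1 - f2 - f3) * ((f0 - f1 + f2 - f3) * (f0 - f1 - f2 + f3))).
  by rewrite /klein_det; ring.
have [|||[t ->]|[_ [t ->]]] := @four_linear (f0 + f1 + f2 + f3 + 2) (f0 + f1 - f2 - f3)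
  (f0 - f1 + f2 - f3) (f0 - f1 - f2 + f3) (f0 + f1 + 1) (f0 - f1); try ring.
- by rewrite /oddz; lia.
- by left; exists (4 * t); ring.
- by right; exists (f0 + t); ring.
Qed.

Lemma sqrz_mod4 (x : int) : (exists t, x ^+ 2 = 4 * t) \/ (exists t, x ^+ 2 = 1 + 4 * t).
Proof.
have [/oddzP[f ->]|/evenzP[f ->]] := boolP (oddz x).
  by right; exists (f ^+ 2 + f); ring.
by left; exists (f ^+ 2); ring.
Qed.

Lemma mod4_01_mul (x y : int) :
  (exists t, x = 4 * t) \/ (exists t, x = 1 + 4 * t) ->
  (exists t, y = 4 * t) \/ (exists t, y = 1 + 4 * t) ->
  (exists t, x * y = 4 * t) \/ (exists t, x * y = 1 + 4 * t).
Proof.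
move=> [[t ->]|[t ->]] [[r ->]|[r ->]]; [left; exists (4 * t * r) | left; exists (t * (1 + 4 * r))
  | left; exists ((1 + 4 * t) * r) | right; exists (t + r + 4 * t * r)]; ring.
Qed.

Lemma mod4_03_mul (x y : int) :
  (exists t, x = 4 * t) \/ (exists t, x = 3 + 4 * t) ->
  (exists t, y = 4 * t) \/ (exists t, y = 3 + 4 * t) ->
  (exists t, x * y = 4 * t) \/ (exists t, x * y = 1 + 4 * t).
Proof.
move=> [[t ->]|[t ->]] [[r ->]|[r ->]]; [left; exists (4 * t * r) | left; exists (t * (3 + 4 * r))
  | left; exists ((3 + 4 * t) * r) | right; exists (2 + 3 * t + 3 * r + 4 * t * r)]; ring.
Qed.

Lemma even_form_mod4 (m : int) :
  (exists t, m = 4 * t) \/ (exists t, m = 1 + 4 * t) -> even_form (2 ^+ 16 * m).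
Proof. by move=> [[t ->]|[t ->]]; [exact: even_form_mul4 | rewrite addrC; exact: even_form_1mod4]. Qed.

Lemma even_form_all_even u v w t :
  compat_coord u -> compat_coord v -> compat_coord w -> compat_coord t ->
  ~~ oddz u.1.1 -> ~~ oddz v.1.1 -> ~~ oddz w.1.1 -> ~~ oddz t.1.1 ->
  even_form (coord_det u v w t).
Proof.
case: u v w t => -[c0 d0] [c0' d0'] [[c1 d1] [c1' d1']] [[c2 d2] [c2' d2']] [[c3 d3] [c3' d3']].
rewrite /compat_coord /coord_det /=.
move=> [i0 [j0 [k0 [-> -> ->]]]] [i1 [j1 [k1 [-> -> ->]]]].
move=> [i2 [j2 [k2 [-> -> ->]]]] [i3 [j3 [k3 [-> -> ->]]]].
move=> /evenzP[f0 ->] /evenzP[f1 ->] /evenzP[f2 ->] /evenzP[f3 ->].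
have K2 a b c d : klein_det (2 * a) (2 * b) (2 * c) (2 * d) = 16 * klein_det a b c d :> int.
  by rewrite /klein_det; ring.
have N2 a b c d : norm4 (2 * a) (2 * b) (2 * c) (2 * d) = 4 * norm4 a b c d :> int.
  by rewrite /norm4; ring.
rewrite !halvingE !K2 !N2.
set K := klein_det _ _ _ _; set K' := klein_det _ _ _ _.
set N := norm4 _ _ _ _; set N' := norm4 _ _ _ _.
have -> : 16 * K * (4 * N) ^+ 2 * (16 * K' * (4 * N') ^+ 2) =
  2 ^+ 16 * (K * N ^+ 2 * (K' * N' ^+ 2)) by ring.
by apply: even_form_mod4; apply: mod4_01_mul; apply: mod4_01_mul;
  first [exact: klein_det_mod4 | exact: sqrz_mod4].
Qed.

Lemma even_form_all_odd u v w t :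
  compat_coord u -> compat_coord v -> compat_coord w -> compat_coord t ->
  oddz u.1.1 -> oddz v.1.1 -> oddz w.1.1 -> oddz t.1.1 ->
  even_form (coord_det u v w t).
Proof.
case: u v w t => -[c0 d0] [c0' d0'] [[c1 d1] [c1' d1']] [[c2 d2] [c2' d2']] [[c3 d3] [c3' d3']].
rewrite /compat_coord /coord_det /=.
move=> [i0 [j0 [k0 [-> -> ->]]]] [i1 [j1 [k1 [-> -> ->]]]].
move=> [i2 [j2 [k2 [-> -> ->]]]] [i3 [j3 [k3 [-> -> ->]]]].
move=> /oddzP[f0 ->] /oddzP[f1 ->] /oddzP[f2 ->] /oddzP[f3 ->].
have Nodd a b c d : exists l, norm4 (2 * a + 1) (2 * b + 1) (2 * c + 1) (2 * d + 1) = 4 * l :> int.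
  exists (a ^+ 2 + a + b ^+ 2 + b + c ^+ 2 + c + d ^+ 2 + d + 1).
  by rewrite /norm4; ring.
rewrite !halvingE.
have [k -> k03] := klein_det_all_odd f0 f1 f2 f3.
have [k' -> k03'] := klein_det_all_odd (f0 + j0) (f1 + j1) (f2 + j2) (f3 + j3).
have [l ->] := Nodd (f0 + i0) (f1 + i1) (f2 + i2) (f3 + i3).
set N := norm4 _ _ _ _; have [l' ->] : exists l', N = 4 * l' by apply: Nodd.
have -> : 16 * k * (4 * l) ^+ 2 * (16 * k' * (4 * l') ^+ 2) =
  2 ^+ 16 * (k * k' * (l ^+ 2 * l' ^+ 2)) by ring.
apply: even_form_mod4; apply: mod4_01_mul; first exact: mod4_03_mul.
by apply: mod4_01_mul; apply: sqrz_mod4.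
Qed.

(** * Even determinants with two odd coordinates *)

Definition pm3_mod8 (f : int) : Prop := exists t, f = 3 + 8 * t \/ f = 5 + 8 * t.

(* The possible k in K(c) = 64 k when c0, c1 are odd, c2 = 2 f and c2 + c3 = 0
   mod 4.  The last two cases are what makes 2^16 m with m = 7 mod 8 exceptional: they
   force different parities of f for c and c'. *)
Definition residue_type (k f : int) : Prop :=
  [\/ exists t, k = 4 * t,
      oddz k /\ exists x y, k = x * y /\ pm3_mod8 x,
      (exists t, k = 1 + 8 * t) /\ ~~ oddz f
    | (exists t, k = 7 + 8 * t) /\ oddz f].


(* c0 + c1 = 2 (2 g + 1), c2 + c3 = 4 h, c0 - c1 = 4 u and c2 - c3 = 4 w. *)
Lemma residue_type_core (g h u w : int) :
  residue_type (((2 * g + 1) ^+ 2 - (2 * h) ^+ 2) * (u ^+ 2 - w ^+ 2)) (h + w).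
Proof.
have [a ->] := sqr_oddz g; have [b ->] := sqr_even_mod8 h.
have pm3 (k x y : int) : oddz k -> k = x * y -> pm3_mod8 x -> residue_type k (h + w).
  by move=> ok kxy px; constructor 2; split=> //; exists x, y.
set p := _ - _; have p_odd : oddz p by rewrite /p /oddz; lia.
have by_p q : oddz h -> oddz q -> residue_type (p * q) (h + w).
  move=> /oddzP[h' Eh] q_odd; apply: (pm3 _ p q); rewrite ?oddzM ?p_odd ?q_odd //.
  by exists (a - b - h' - 1); right; rewrite /p Eh; ring.
have by_q q : pm3_mod8 q -> residue_type (p * q) (h + w).
  move=> q3; have q_odd : oddz q by case: q3 => t [] ->; rewrite /oddz; lia.
  by apply: (pm3 _ q p) q3; rewrite ?oddzM ?p_odd // mulrC.
have p1 h' : h = 2 * h' -> p = 1 + 8 * (a - h' - b) by move=> Eh; rewrite /p Eh; ring.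
(* If u and w have equal parity, 4 divides u^2 - w^2. Otherwise both factors are odd; p is 5 or 1
   modulo 8 as h is odd or even, and u^2 - w^2 is either 3 or 5 modulo 8 or settles one of the last
   two cases. *)
have [/oddzP[u' ->]|/evenzP[u' ->]] := boolP (oddz u);
  have [/oddzP[w' Ew]|/evenzP[w' Ew]] := boolP (oddz w); rewrite {1}Ew.
- by constructor 1; exists (p * (u' ^+ 2 + u' - (w' ^+ 2 + w'))); ring.
- have [c ->] := sqr_oddz u'; have [d ->] := sqr_even_mod8 w'.
  have [oh|/evenzP[h' Eh]] := boolP (oddz h); first by apply: by_p => //; rewrite /oddz; lia.
  have [/oddzP[v Ev]|/evenzP[v Ev]] := boolP (oddz w').
    by apply: by_q; exists (c - v - d - 1); right; rewrite Ev; ring.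
  constructor 3; rewrite (p1 h') // Ev Eh Ew /oddz; split; last by lia.
  by exists ((a - h' - b) + (c - v - d) + 8 * (a - h' - b) * (c - v - d)); ring.
- have [c ->] := sqr_oddz w'; have [d ->] := sqr_even_mod8 u'.
  have [oh|/evenzP[h' Eh]] := boolP (oddz h); first by apply: by_p => //; rewrite /oddz; lia.
  have [/oddzP[v Ev]|/evenzP[v Ev]] := boolP (oddz u').
    by apply: by_q; exists (v + d - c); left; rewrite Ev; ring.
  constructor 4; rewrite (p1 h') // Ev Eh Ew /oddz; split; last by lia.
  exists (7 * (a - h' - b) + (v + d - c - 1) + 8 * (a - h' - b) * (v + d - c - 1)); ring.
- by constructor 1; exists (p * (u' ^+ 2 - w' ^+ 2)); ring.
Qed.

(** Exactly one of c0 + c1 and c0 - c1 is divisible by 4. Negating c1 and c3 fixes K and exchanges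
    the two, which is why the second parity swaps the roles of sums and differences. *)
Lemma klein_det_two_odd_even (f0 f1 f2 f3 : int) : ~~ oddz (f2 + f3) ->
  exists2 k, klein_det (2 * f0 + 1) (2 * f1 + 1) (2 * f2) (2 * f3) = 64 * k & residue_type k f2.
Proof.
move=> e23; have [/oddzP[g Eg]|/evenzP[g Eg]] := boolP (oddz (f0 + f1)).
  have [h Eh] := evenzP e23.
  have := residue_type_core (f0 - g - 1) (f2 - h) (g + 1) h; rewrite subrK => rt.
  exists ((((2 * (f0 - g - 1) + 1) ^+ 2 - (2 * (f2 - h)) ^+ 2) * ((g + 1) ^+ 2 - h ^+ 2))) => //.
  have -> : f1 = 2 * g + 1 - f0 by rewrite -Eg; ring.
  have -> : f3 = 2 * h - f2 by rewrite -Eh; ring.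
  by rewrite /klein_det; ring.
have [h Eh] := evenzP e23.
have := residue_type_core g h (f0 - g) (f2 - h); rewrite (addrC h) subrK => rt.
exists (((2 * g + 1) ^+ 2 - (2 * h) ^+ 2) * ((f0 - g) ^+ 2 - (f2 - h) ^+ 2)) => //.
have -> : f1 = 2 * g - f0 by rewrite -Eg; ring.
have -> : f3 = 2 * h - f2 by rewrite -Eh; ring.
by rewrite /klein_det; ring.
Qed.

(** Since f0 + f1 + 1 and f0 - f1 have opposite parity, one factor is a difference of two odd
    squares and contributes 8 to the evident 16. *)
Lemma klein_det_two_odd_odd (f0 f1 f2 f3 : int) : oddz (f2 + f3) ->
  exists k, klein_det (2 * f0 + 1) (2 * f1 + 1) (2 * f2) (2 * f3) = 128 * k.
Proof.
move=> /oddzP[h Eh].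
have {Eh} -> : f3 = 2 * h + 1 - f2 by rewrite -Eh; ring.
have -> : klein_det (2 * f0 + 1) (2 * f1 + 1) (2 * f2) (2 * (2 * h + 1 - f2)) =
  16 * (((f0 + f1 + 1) ^+ 2 - (2 * h + 1) ^+ 2) * ((f0 - f1) ^+ 2 - (2 * (f2 - h - 1) + 1) ^+ 2)).
  by rewrite /klein_det; ring.
have [a ->] := sqr_oddz h; have [b ->] := sqr_oddz (f2 - h - 1).
have [/oddzP[g Eg]|/evenzP[g Eg]] := boolP (oddz (f0 + f1)).
  have -> : f0 - f1 = 2 * (f0 - g - 1) + 1.
    by have -> : f1 = 2 * g + 1 - f0 by [rewrite -Eg; ring]; ring.
  have [c ->] := sqr_oddz (f0 - g - 1).
  by exists (((f0 + f1 + 1) ^+ 2 - (1 + 8 * a)) * (c - b)); ring.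
rewrite Eg; have [c ->] := sqr_oddz g.
by exists ((c - a) * ((f0 - f1) ^+ 2 - (1 + 8 * b))); ring.
Qed.

(** Norm 2 is used up by the two odd coordinates; the last clause later excludes l < 5 in the
    exceptional family. *)
Lemma norm4_two_odd (a b c d : int) :
  exists2 l : nat, norm4 (2 * a + 1) (2 * b + 1) (2 * c) (2 * d) = 2 * l%:Z &
  [/\ exists t, l%:Z = 1 + 2 * (c + d) + 4 * t, (0 < l)%N & l = 1%N -> c = 0 /\ d = 0].
Proof.
have [x Ex] := sqr_oddz a; have [y Ey] := sqr_oddz b.
have [z Ez] := sqrz_mod2 c; have [w Ew] := sqrz_mod2 d.
have := sqr_ge0 c; have := sqr_ge0 d; have := sqr_ge0 (2 * a + 1); have := sqr_ge0 (2 * b + 1).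
have := norm4_ge0 (2 * a + 1) (2 * b + 1) (2 * c) (2 * d).
have NE : norm4 (2 * a + 1) (2 * b + 1) (2 * c) (2 * d) = 
  2 * (1 + 4 * x + 4 * y + 2 * c ^+ 2 + 2 * d ^+ 2).
  by rewrite /norm4 Ex Ey; ring.
rewrite NE Ex Ey => N_ge0 y_ge0 x_ge0 d_ge0 c_ge0.
exists (absz (1 + 4 * x + 4 * y + 2 * c ^+ 2 + 2 * d ^+ 2)); first by rewrite gez0_abs //; lia.
split; [|lia|].
  by rewrite gez0_abs; [exists (x + y + z + w); rewrite Ez Ew; ring | lia].
move=> E1; have : 4 * x + 4 * y + 2 * c ^+ 2 + 2 * d ^+ 2 = 0 by lia.
move=> E; split; apply/eqP; rewrite -sqrf_eq0; apply/eqP; move: E x_ge0 y_ge0 d_ge0 c_ge0; clear; lia.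
Qed.

(** If the least prime factor is not 3 modulo 4, the cofactor is, and induction applies. *)
Lemma prime_3mod4_dvd (l : nat) : (l %% 4 = 3)%N ->
  exists p, [/\ prime p, (p %% 4 = 3)%N & (p %| l)%N].
Proof.
elim/ltn_ind: l => l IH l3; have l_gt1 : (1 < l)%N by case: l l3 {IH} => [|[|]].
have p_pr := pdiv_prime l_gt1; have /dvdnP[m Em] := pdiv_dvd l.
have [p3|p3] := eqVneq (pdiv l %% 4)%N 3%N; first by exists (pdiv l); rewrite p_pr pdiv_dvd.
have m3 : (m %% 4 = 3)%N.
  have : ((m * pdiv l) %% 4 = 3)%N by rewrite -Em.
  rewrite -modnMm; move: p3.
  have := ltn_pmod (pdiv l) (isT : (0 < 4)%N); have := ltn_pmod m (isT : (0 < 4)%N).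
  by case: (m %% 4)%N => [|[|[|[|]]]] // _; case: (pdiv l %% 4)%N => [|[|[|[|]]]].
have [||p [pp p3' pm]] := IH m => //; last by exists p; split=> //; rewrite Em dvdn_mulr.
have := prime_gt1 p_pr; move: (pdiv l) Em l_gt1 => q -> _ q_gt1.
by rewrite ltn_Pmulr //; case: m m3 {IH}.
Qed.

Lemma even_form_17 (k : int) (l : nat) : (exists l1 l2 : nat, l = (l1 * l2)%N /\ (l1 %% 4 = 3)%N) ->
  even_form (2 ^+ 17 * k * l%:Z ^+ 2).
Proof.
move=> [l1 [l2 [-> /prime_3mod4_dvd[p [p_pr p3 /dvdnP[q ->]]]]]].
have [/oddzP[f Ef]|/evenzP[f Ef]] := boolP (oddz (k * (q * l2)%N%:Z ^+ 2)).
  constructor 2; exists f, p; split=> //.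
  by rewrite -Ef !PoszM; ring.
constructor 1; exists (f * p%:Z ^+ 2).
have -> : 2 ^+ 17 * k * (q * p * l2)%N%:Z ^+ 2 = 2 ^+ 17 * (k * (q * l2)%N%:Z ^+ 2) * p%:Z ^+ 2.
  by rewrite !PoszM; ring.
by rewrite Ef; ring.
Qed.

(** In a product that is 7 modulo 8, the cofactor of 3 is 5 and conversely. *)
Lemma pm3_mod8_divisor (x y t : int) : x * y = 7 + 8 * t -> pm3_mod8 x ->
  exists a b, x * y = (8 * a + 3) * (8 * b - 3).
Proof.
move=> E [s [Ex|Ex]]; rewrite {}Ex in E *;
  [exists s, ((y + 3) %/ 8)%Z | exists ((y - 3) %/ 8)%Z, (s + 1)].
  have E' : 3 * y + 8 * (s * y) = 7 + 8 * t by rewrite -E; ring.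
  by rewrite (addrC 3); congr (_ * _); move: (s * y) E' => sy; lia.
have E' : 5 * y + 8 * (s * y) = 7 + 8 * t by rewrite -E; ring.
by rewrite mulrC; congr (_ * _); move: (s * y) E' => sy; lia.
Qed.

Lemma mod4_1_sqr (l : nat) : (l %% 4 = 1)%N -> exists e, l%:Z ^+ 2 = 1 + 8 * e.
Proof.
move=> l1; have [e E] := sqr_oddz (l./2)%:Z; exists e; rewrite -E; congr (_ ^+ 2); lia.
Qed.

(** When the value is 7 modulo 8, either k or k' has a divisor 3 or 5 modulo 8, or one is 1 and the
    other 7 modulo 8. In the latter case f and f' differ in parity, which forces l >= 5. *)
Lemma even_form_16 (k k' f f' : int) (l : nat) :
  residue_type k f -> residue_type k' f' -> (l %% 4 = 1)%N ->
  ((l < 5)%N -> oddz f = oddz f') -> even_form (2 ^+ 16 * (k * k' * l%:Z ^+ 2)).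
Proof.
move=> kf kf' l1 small_l.
have [E|[m8 E]] : (exists t, k * k' = 4 * t) \/ (oddz k /\ oddz k').
  case: kf => [[t ->]|[ok _]|[[t ->] _]|[[t ->] _]].
  - by left; exists (t * k'); ring.
  - case: kf' => [[t ->]|[ok' _]|[[t ->] _]|[[t ->] _]]; [left; exists (k * t); ring | | |];
      by right; split=> //; rewrite /oddz; lia.
  - case: kf' => [[r ->]|[ok' _]|[[r ->] _]|[[r ->] _]]; [left; exists ((1 + 8 * t) * r); ring | | |];
      by right; split=> //; rewrite /oddz; lia.
  - case: kf' => [[r ->]|[ok' _]|[[r ->] _]|[[r ->] _]]; [left; exists ((7 + 8 * t) * r); ring | | |];
      by right; split=> //; rewrite /oddz; lia.
  by case: E => t ->; rewrite -mulrA; exact: even_form_mul4.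
have [e Ee] := mod4_1_sqr l1.
have om : oddz (k * k' * l%:Z ^+ 2) by rewrite Ee !oddzM m8 E /= /oddz; lia.
set m := k * k' * _ in om *.
have [m7|m7] := eqVneq (m %% 8)%Z 7%Z; last first.
  constructor 3; exists m; split=> //.
  have : [|| (m %% 8)%Z == 1, (m %% 8)%Z == 3 | (m %% 8)%Z == 5] by move: om m7; rewrite /oddz; lia.
  by case/or3P => /eqP ->; [constructor 1 | constructor 2 | constructor 3].
constructor 4; exists m; split=> //.
have [t Et] : exists t, m = 7 + 8 * t by exists (m %/ 8)%Z; lia.
have via_divisor x y : m = x * y -> pm3_mod8 x ->
    exists a b, 2 ^+ 16 * m = 2 ^+ 16 * (8 * a + 3) * (8 * b - 3).
  move=> mxy x3; rewrite mxy in Et *; have [a [b ->]] := pm3_mod8_divisor Et x3.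
  by exists a, b; ring.
have kk7 : (exists a, k * k' = 7 + 8 * a).
  exists (t - k * k' * e); rewrite mulrBr addrA -Et /m Ee; ring.
case: kf => [[r Ek]|[_ [x [y [Ek x3]]]]|[[r Ek] of_]|[[r Ek] of_]].
- by move: m8; rewrite Ek /oddz; lia.
- by right; apply: (via_divisor x (y * k' * l%:Z ^+ 2)) => //; rewrite /m Ek; ring.
- case: kf' => [[s Ek']|[_ [x [y [Ek' x3]]]]|[[s Ek'] of']|[[s Ek'] of']].
  + by move: E; rewrite Ek' /oddz; lia.
  + by right; apply: (via_divisor x (y * k * l%:Z ^+ 2)) => //; rewrite /m Ek'; ring.
  + case: kk7 => a; rewrite Ek Ek' => kk7; exfalso; move: kk7.
    have -> : (1 + 8 * r) * (1 + 8 * s) = 1 + 8 * (r + s + 8 * r * s) by ring.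
    by move: (r + s + 8 * r * s); lia.
  left; case: kk7 => a Ea; exists (a + 1), l; split; [lia | lia | | by rewrite /m Ea; ring].
  by rewrite leqNgt; apply/negP => /small_l; rewrite of' (negbTE of_).
- case: kf' => [[s Ek']|[_ [x [y [Ek' x3]]]]|[[s Ek'] of']|[[s Ek'] of']].
  + by move: E; rewrite Ek' /oddz; lia.
  + by right; apply: (via_divisor x (y * k * l%:Z ^+ 2)) => //; rewrite /m Ek'; ring.
  + left; case: kk7 => a Ea; exists (a + 1), l; split; [lia | lia | | by rewrite /m Ea; ring].
    by rewrite leqNgt; apply/negP => /small_l; rewrite of_ (negbTE of').
  case: kk7 => a; rewrite Ek Ek' => kk7; exfalso; move: kk7.
  have -> : (7 + 8 * r) * (7 + 8 * s) = 1 + 8 * (6 + 7 * r + 7 * s + 8 * r * s) by ring.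
  by move: (6 + 7 * r + 7 * s + 8 * r * s); lia.
Qed.

(** The parity of j2 + j3 tells both whether f2 + f3 and its primed analogue differ in parity and
    whether l1 and l2 differ modulo 4. If they differ, one l is 3 modulo 4 and supplies the prime
    p. *)
Lemma even_form_two_odd u v w t :
  compat_coord u -> compat_coord v -> compat_coord w -> compat_coord t ->
  oddz u.1.1 -> oddz v.1.1 -> ~~ oddz w.1.1 -> ~~ oddz t.1.1 ->
  even_form (coord_det u v w t).
Proof.
case: u v w t => -[c0 d0] [c0' d0'] [[c1 d1] [c1' d1']] [[c2 d2] [c2' d2']] [[c3 d3] [c3' d3']].
rewrite /compat_coord /coord_det /=.
move=> [i0 [j0 [k0 [-> -> ->]]]] [i1 [j1 [k1 [-> -> ->]]]].
move=> [i2 [j2 [k2 [-> -> ->]]]] [i3 [j3 [k3 [-> -> ->]]]].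
move=> /oddzP[f0 ->] /oddzP[f1 ->] /evenzP[f2 ->] /evenzP[f3 ->].
rewrite !halvingE.
have [l1 -> [[a1 A1] l1_gt0 l1_1]] := norm4_two_odd (f0 + i0) (f1 + i1) (f2 + i2) (f3 + i3).
have [l2 -> [[a2 A2] l2_gt0 l2_1]] := norm4_two_odd (f0 + i0 + j0 + 2 * k0)
  (f1 + i1 + j1 + 2 * k1) (f2 + i2 + j2 + 2 * k2) (f3 + i3 + j3 + 2 * k3).
have [o|e] := boolP (oddz (f2 + f3)); have [o'|e'] := boolP (oddz (f2 + j2 + (f3 + j3))).
- have [x ->] := klein_det_two_odd_odd f0 f1 o.
  have [y ->] := klein_det_two_odd_odd (f0 + j0) (f1 + j1) o'.
  by constructor 1; exists (x * y * l1%:Z ^+ 2 * l2%:Z ^+ 2); ring.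
- have [x ->] := klein_det_two_odd_odd f0 f1 o.
  have [y -> _] := klein_det_two_odd_even (f0 + j0) (f1 + j1) e'.
  have -> : 128 * x * (2 * l1%:Z) ^+ 2 * (64 * y * (2 * l2%:Z) ^+ 2) =
    2 ^+ 17 * (x * y) * (l1 * l2)%N%:Z ^+ 2 by rewrite PoszM; ring.
  apply: even_form_17.
  have [l13|l13] := eqVneq (l1 %% 4)%N 3%N; first by exists l1, l2.
  exists l2, l1; split; first exact: mulnC.
  by move: A1 A2 l13 o e'; rewrite /oddz; clear; lia.
- have [x -> _] := klein_det_two_odd_even f0 f1 e.
  have [y ->] := klein_det_two_odd_odd (f0 + j0) (f1 + j1) o'.
  have -> : 64 * x * (2 * l1%:Z) ^+ 2 * (128 * y * (2 * l2%:Z) ^+ 2) =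
    2 ^+ 17 * (x * y) * (l1 * l2)%N%:Z ^+ 2 by rewrite PoszM; ring.
  apply: even_form_17.
  have [l13|l13] := eqVneq (l1 %% 4)%N 3%N; first by exists l1, l2.
  exists l2, l1; split; first exact: mulnC.
  by move: A1 A2 l13 e o'; rewrite /oddz; clear; lia.
have [x -> X] := klein_det_two_odd_even f0 f1 e.
have [y -> Y] := klein_det_two_odd_even (f0 + j0) (f1 + j1) e'.
have -> : 64 * x * (2 * l1%:Z) ^+ 2 * (64 * y * (2 * l2%:Z) ^+ 2) =
  2 ^+ 16 * (x * y * (l1 * l2)%N%:Z ^+ 2) by rewrite PoszM; ring.
have l12 : (l1 %% 4 = l2 %% 4)%N by move: A1 A2 e e'; rewrite /oddz; clear; lia.
have l1_odd : (l1 %% 4 = 1)%N \/ (l1 %% 4 = 3)%N by move: A1; clear; lia.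
have l1l2 : (l1 * l2 %% 4 = 1)%N by rewrite -modnMm -l12; case: l1_odd => ->.
apply: (even_form_16 X Y l1l2) => small.
(* Both norms are then 2, so d2 = d2' = 0; this makes j2 even, and c2/2 and c2'/2 have the same
   parity. *)
have l12_1 : (l1 * l2 = 1)%N by move: l1l2 small; clear; lia.
have [L1 L2] : l1 = 1%N /\ l2 = 1%N by move/eqP: l12_1; rewrite muln_eq1 => /andP[/eqP -> /eqP ->].
have [F2 F3] := l1_1 L1; have [G2 G3] := l2_1 L2.
by move: F2 G2; rewrite /oddz; clear; lia.
Qed.

(** * Special representations by four squares *)

Lemma sum4_sorted (n : int) : sum4 n -> exists a b c d : int, n = norm4 a b c d /\
  [/\ oddz b -> oddz a, oddz c -> oddz b & oddz d -> oddz c].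
Proof.
move=> [a [b [c [d E]]]].
by apply: (@sort4 _ oddz (fun x y z t => n = norm4 x y z t)) E => x y z t ->; rewrite /norm4; ring.
Qed.

Lemma sqr_parity (x : int) :
  (exists f t, [/\ x = 2 * f + 1, x ^+ 2 = 1 + 8 * t & oddz x]) \/
  (exists f t, [/\ x = 2 * f, x ^+ 2 = 4 * f + 8 * t & ~~ oddz x]).
Proof.
have [ox|ex] := boolP (oddz x); [left | right].
  by have [f Ef] := oddzP ox; have [t Et] := sqr_oddz f; exists f, t; rewrite {2}Ef Et.
by have [f Ef] := evenzP ex; have [t Et] := sqr_even_mod8 f; exists f, t; rewrite {2}Ef Et.
Qed.

(** Modulo 4 exactly three squares are odd, and an odd number is 1 modulo 4 up to sign. *)
Lemma norm4_3mod4 (l : nat) : (l %% 4 = 3)%N -> exists e x y z : int,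
  l%:Z = norm4 (2 * e) (4 * x + 1) (4 * y + 1) (4 * z + 1).
Proof.
move=> l3; have [a [b [c [d [E [ba cb dc]]]]]] := sum4_sorted (sum4_nat l).
have odd_sign (x : int) : oddz x -> exists y, x ^+ 2 = (4 * y + 1) ^+ 2.
  move=> /oddzP[f ->]; have [/oddzP[g ->]|/evenzP[g ->]] := boolP (oddz f).
    by exists (- g - 1); ring.
  by exists g; ring.
have [oa ob oc] : [/\ oddz a, oddz b & oddz c].
  have [[fa [ta [_ Ea oa]]]|[fa [ta [_ Ea oa]]]] := sqr_parity a;
    have [[fb [tb [_ Eb ob]]]|[fb [tb [_ Eb ob]]]] := sqr_parity b;
    have [[fc [tc [_ Ec oc]]]|[fc [tc [_ Ec oc]]]] := sqr_parity c;
    have [[fd [td [_ Ed od]]]|[fd [td [_ Ed od]]]] := sqr_parity d;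
    move: E; rewrite /norm4 Ea Eb Ec Ed => E; split=> //; exfalso;
    first [ by move: l3 E; clear; lia
          | by case/negP: oa; auto | by case/negP: ob; auto | by case/negP: oc; auto ].
have ed : ~~ oddz d.
  apply/negP => od; move: E; rewrite /norm4.
  have [x ->] := oddzP oa; have [y ->] := oddzP ob; have [z ->] := oddzP oc; have [w ->] := oddzP od.
  have [x' ->] := sqr_oddz x; have [y' ->] := sqr_oddz y; have [z' ->] := sqr_oddz z.
  have [w' ->] := sqr_oddz w.
  by move: l3; clear; lia.
have [e Ee] := evenzP ed; have [x Ex] := odd_sign _ oa; have [y Ey] := odd_sign _ ob.
have [z Ez] := odd_sign _ oc; exists e, x, y, z.
by rewrite E /norm4 -Ee -Ex -Ey -Ez; ring.
Qed.

(** From (x + y)^2 + (x - y)^2 = 2 x^2 + 2 y^2, pairing the even coordinate with one odd coordinate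
    and the other two odd ones together. *)
Lemma double_norm4_3mod4 (l : nat) : (l %% 4 = 3)%N -> exists d0 d1 d2 d3 : int,
  [/\ oddz d0, oddz d1, (4 %| d2 - 2)%Z, (4 %| d3)%Z & 2 * l%:Z = norm4 d0 d1 d2 d3].
Proof.
move=> /norm4_3mod4[e [x [y [z ->]]]].
exists (2 * e + (4 * x + 1)), (2 * e - (4 * x + 1)), (4 * y + 1 + (4 * z + 1)),
  (4 * y + 1 - (4 * z + 1)).
split; [rewrite /oddz; lia .. | by rewrite /norm4; ring].
Qed.

(* 1, 2, 2, 0 are the residues modulo 4 of x (up to sign), y, z, w. *)
Definition sum4_1220 (n : int) : Prop := exists x y z w : int,
  [/\ oddz x, (4 %| y - 2)%Z, (4 %| z - 2)%Z & (4 %| w)%Z] /\ n = norm4 x y z w.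

Lemma double_sum4_1220 (n : int) : sum4_1220 n -> exists d0 d1 d2 d3 : int,
  [/\ oddz d0, oddz d1, (4 %| d2 - 2)%Z, (4 %| d3 - 2)%Z & 2 * n = norm4 d0 d1 d2 d3].
Proof.
move=> [x [y [z [w [[ox y2 z2 w0] ->]]]]]; exists (x + y), (x - y), (z + w), (z - w).
move: ox; rewrite /oddz => ox; split; [rewrite /oddz; lia .. | by rewrite /norm4; ring].
Qed.

(* The new quaternion is u (a + b i + c j + d k) u' / 3 with u = i + j + k and
   u' = i + j - k; the congruence modulo 3 is its integrality. *)
Lemma sum4_1220_step (a b c d : int) : oddz a -> (4 %| b)%Z -> (4 %| c)%Z -> (4 %| d)%Z ->
  (3 %| a - b + c)%Z -> sum4_1220 (norm4 a b c d).
Proof.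
move=> oa b4 c4 d4 /dvdzP[k Ek].
pose x := - k - b + c; pose y := - 2 * k - b; pose z := 2 * k - c.
have Ea : a = 3 * k + b - c by rewrite mulrC -Ek; ring.
exists x, y, z, d; split; last by rewrite Ea /norm4 /x /y /z; ring.
by move: oa; rewrite /x /y /z /oddz Ea => oa; split; lia.
Qed.

(** Modulo 3, b - c, c - d, d - b is an arithmetic progression whose difference is b + c + d up to
    sign; this being nonzero, one term equals a. *)
Lemma sum4_1220_mod3 (a b c d : int) : oddz a -> (4 %| b)%Z -> (4 %| c)%Z -> (4 %| d)%Z ->
  ~~ (3 %| b + c + d)%Z -> sum4_1220 (norm4 a b c d).
Proof.
move=> oa b4 c4 d4 s3.
have : [|| (3 %| a - b + c)%Z, (3 %| a - c + d)%Z | (3 %| a - d + b)%Z] by clear oa b4 c4 d4; lia.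
case/or3P => h; [exact: sum4_1220_step | |].
- have -> : norm4 a b c d = norm4 a c d b by rewrite /norm4; ring.
  exact: sum4_1220_step.
have -> : norm4 a b c d = norm4 a d b c by rewrite /norm4; ring.
exact: sum4_1220_step.
Qed.

(** If 3 divided all four signed sums, it would divide their differences 2 b and 2 c, hence all
    three numbers. *)
Lemma sign_not_dvd3 (b c d : int) : ~~ ((3 %| b)%Z && (3 %| c)%Z && (3 %| d)%Z) ->
  exists b' c', [/\ b' = b \/ b' = - b, c' = c \/ c' = - c & ~~ (3 %| b' + c' + d)%Z].
Proof.
move=> nd; have : [|| ~~ (3 %| b + c + d)%Z, ~~ (3 %| - b + c + d)%Z,
   ~~ (3 %| b - c + d)%Z | ~~ (3 %| - b - c + d)%Z] by lia.
by case/or4P => h; [exists b, c | exists (- b), c | exists b, (- c) | exists (- b), (- c)]; split; auto.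
Qed.

(* (2 s - 3 b', 2 s - 3 c', 2 s - 3 d) is 3 times the half turn of (b', c', d) about
   (1, 1, 1), so the power of 3 drops by one. *)
Lemma sum4_1220_descent (e : nat) (a b c d : int) : oddz a -> (4 %| b)%Z -> (4 %| c)%Z -> (4 %| d)%Z ->
  ~~ ((3 %| b)%Z && (3 %| c)%Z && (3 %| d)%Z) ->
  sum4_1220 (norm4 a (3 ^+ e * b) (3 ^+ e * c) (3 ^+ e * d)).
Proof.
move=> oa; elim: e b c d => [|e IH] b c d b4 c4 d4 /sign_not_dvd3[b' [c' [Eb Ec s3]]].
  rewrite !mul1r (_ : norm4 a b c d = norm4 a b' c' d).
    by apply: sum4_1220_mod3 => //; [case: Eb => -> | case: Ec => ->]; lia.
  by rewrite /norm4; case: Eb => ->; case: Ec => ->; rewrite ?sqrrN.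
pose s := b' + c' + d.
rewrite (_ : norm4 _ _ _ _ = norm4 a (3 ^+ e * (2 * s - 3 * b'))
    (3 ^+ e * (2 * s - 3 * c')) (3 ^+ e * (2 * s - 3 * d))).
  apply: IH; rewrite /s; try (by case: Eb => ->; case: Ec => ->; lia).
  by apply: contra s3; clear; lia.
have -> : norm4 a (3 ^+ e.+1 * b) (3 ^+ e.+1 * c) (3 ^+ e.+1 * d) =
  norm4 a (3 ^+ e.+1 * b') (3 ^+ e.+1 * c') (3 ^+ e.+1 * d).
  by rewrite /norm4; case: Eb => ->; case: Ec => ->; rewrite ?mulrN ?sqrrN.
by rewrite /norm4 /s !exprS; move: (3 ^+ e) => E; ring.
Qed.

Lemma sum4_1220_of_mod4 (a b c d : int) : oddz a -> (4 %| b)%Z -> (4 %| c)%Z -> (4 %| d)%Z ->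
  [|| b != 0, c != 0 | d != 0] -> sum4_1220 (norm4 a b c d).
Proof.
move=> oa b4 c4 d4 nz.
suff [e [b' [c' [d' [-> -> -> [? ? ?] ?]]]]] : exists e b' c' d', [/\ b = 3 ^+ e * b',
    c = 3 ^+ e * c', d = 3 ^+ e * d', [/\ (4 %| b')%Z, (4 %| c')%Z & (4 %| d')%Z] &
    ~~ ((3 %| b')%Z && (3 %| c')%Z && (3 %| d')%Z)] by exact: sum4_1220_descent.
have [n le_n] := ubnP (`|b| + `|c| + `|d|)%N.
elim: n b c d b4 c4 d4 nz le_n => // n IH b c d b4 c4 d4 nz le_n.
have [/andP[/andP[/dvdzP[b1 E1] /dvdzP[c1 E2]] /dvdzP[d1 E3]]|nd] :=
    boolP ((3 %| b)%Z && (3 %| c)%Z && (3 %| d)%Z); last first.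
  by exists 0%N, b, c, d; rewrite !mul1r; split.
have [||||| e [b' [c' [d' [Eb Ec Ed div4 nd]]]]] := IH b1 c1 d1; try by clear IH; lia.
by exists e.+1, b', c', d'; rewrite E1 E2 E3 Eb Ec Ed !exprSr; split=> //; ring.
Qed.

Lemma prime_neq_sqrz (p : nat) (a : int) : prime p -> p%:Z <> a ^+ 2.
Proof.
move=> p_pr /(congr1 absz); rewrite abszX /= => E.
have : (`|a| %| p)%N by rewrite E expnS dvdn_mulr.
have [a1|a1] := eqVneq `|a|%N 1%N; first by move: p_pr; rewrite E a1.
move=> /(prime_nt_dvdP p_pr a1) ap; move: (prime_gt1 p_pr); rewrite -ap in E *.
by move: E; clear; nia.
Qed.

(** Modulo 4 a single coordinate is odd; modulo 8 the halves of the others have even sum. Either two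
    halves are odd, which is the wanted shape, or all are even and the quaternions of norm 3 come
    in. *)
Lemma sum4_1220_prime (p : nat) : prime p -> (p %% 8 = 1)%N -> sum4_1220 p.
Proof.
move=> p_pr p1; have [a [b [c [d [E [ba cb dc]]]]]] := sum4_sorted (sum4_nat p).
have [oa eb ec ed] : [/\ oddz a, ~~ oddz b, ~~ oddz c & ~~ oddz d].
  have [[fa [ta [_ Ea oa]]]|[fa [ta [_ Ea oa]]]] := sqr_parity a;
    have [[fb [tb [_ Eb ob]]]|[fb [tb [_ Eb ob]]]] := sqr_parity b;
    have [[fc [tc [_ Ec oc]]]|[fc [tc [_ Ec oc]]]] := sqr_parity c;
    have [[fd [td [_ Ed od]]]|[fd [td [_ Ed od]]]] := sqr_parity d;
    move: E; rewrite /norm4 Ea Eb Ec Ed => E; split=> //; exfalso;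
    first [ by move: p1 E; clear; lia
          | by case/negP: oa; auto | by case/negP: ob; auto | by case/negP: oc; auto ].
have [x Ex] := oddzP oa; have [r Er] := sqr_oddz x.
have [b' Eb] := evenzP eb; have [c' Ec] := evenzP ec; have [d' Ed] := evenzP ed.
have [tb Tb] := sqr_even_mod8 b'; have [tc Tc] := sqr_even_mod8 c'; have [td Td] := sqr_even_mod8 d'.
have e_sum : ~~ oddz (b' + c' + d').
  move: E p1; rewrite /norm4 Ex Eb Ec Ed Er Tb Tc Td /oddz; clear; lia.
have main y z w : p%:Z = norm4 a (2 * y) (2 * z) (2 * w) -> oddz y -> oddz z -> ~~ oddz w -> sum4_1220 p.
  move=> -> oy oz ow; exists a, (2 * y), (2 * z), (2 * w); split=> //.
  by split=> //; move: oy oz ow; rewrite /oddz; clear; lia.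
have [ob|eb'] := boolP (oddz b'); have [oc|ec'] := boolP (oddz c').
- apply: (main b' c' d') => //; rewrite -?Eb -?Ec -?Ed //.
  by move: e_sum ob oc; rewrite /oddz; clear; lia.
- apply: (main b' d' c') => //; first by rewrite -Eb -Ec -Ed E /norm4; ring.
  by move: e_sum ob ec'; rewrite /oddz; clear; lia.
- apply: (main c' d' b') => //; first by rewrite -Eb -Ec -Ed E /norm4; ring.
  by move: e_sum oc eb'; rewrite /oddz; clear; lia.
have ed' : ~~ oddz d' by move: e_sum eb' ec'; rewrite /oddz; clear; lia.
rewrite E; apply: sum4_1220_of_mod4 => //.
- by move: eb'; rewrite Eb /oddz; clear; lia.
- by move: ec'; rewrite Ec /oddz; clear; lia.
- by move: ed'; rewrite Ed /oddz; clear; lia.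
apply/negPn/negP; rewrite !negb_or !negbK => /and3P[/eqP b0 /eqP c0 /eqP d0].
by apply: (@prime_neq_sqrz p a p_pr); rewrite E /norm4 b0 c0 d0; ring.
Qed.

(** * Realising the values *)

Lemma det_repI c0 d0 c0' d0' c1 d1 c1' d1' c2 d2 c2' d2' c3 d3 c3' d3' :
  compat c0 d0 c0' d0' -> compat c1 d1 c1' d1' -> compat c2 d2 c2' d2' -> compat c3 d3 c3' d3' ->
  det_rep (klein_det c0 c1 c2 c3 * norm4 d0 d1 d2 d3 ^+ 2 *
          (klein_det c0' c1' c2' c3' * norm4 d0' d1' d2' d3' ^+ 2)).
Proof.
by exists ((c0, d0), (c0', d0')), ((c1, d1), (c1', d1')), ((c2, d2), (c2', d2')), ((c3, d3), (c3', d3')).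
Qed.

Lemma compat_odd_sign (c d c' d' : int) : oddz c -> oddz d -> oddz c' -> oddz d' ->
  compat c d c' d' \/ compat c (- d) c' d'.
Proof.
rewrite /oddz => oc od oc' od'.
have [h|h] := boolP (4 %| c + d - (c' + d'))%Z; [left | right]; apply: compatP; lia.
Qed.

(* Changing the signs of d0 and d1 makes the first two coordinates compatible. *)
Lemma det_rep_two_odd c0 d0 c0' d0' c1 d1 c1' d1' c2 d2 c2' d2' c3 d3 c3' d3' :
  [/\ oddz c0, oddz d0, oddz c0' & oddz d0'] -> [/\ oddz c1, oddz d1, oddz c1' & oddz d1'] ->
  compat c2 d2 c2' d2' -> compat c3 d3 c3' d3' ->
  det_rep (klein_det c0 c1 c2 c3 * norm4 d0 d1 d2 d3 ^+ 2 *
          (klein_det c0' c1' c2' c3' * norm4 d0' d1' d2' d3' ^+ 2)).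
Proof.
move=> [a1 a2 a3 a4] [b1 b2 b3 b4] h2 h3.
have N0 x : norm4 (- d0) x d2 d3 = norm4 d0 x d2 d3 by rewrite /norm4 sqrrN.
have N1 x : norm4 x (- d1) d2 d3 = norm4 x d1 d2 d3 by rewrite /norm4 sqrrN.
case: (compat_odd_sign a1 a2 a3 a4) => h0; case: (compat_odd_sign b1 b2 b3 b4) => h1;
  by have := det_repI h0 h1 h2 h3; rewrite ?N0 ?N1.
Qed.

Lemma det_rep_1mod16 m : det_rep (1 + 16 * m).
Proof.
(* The linear forms at (1 + 4 m, 4 m, 4 m, 4 m) are 1 + 16 m, 1, 1, 1. *)
have -> : 1 + 16 * m = klein_det (1 + 4 * m) (4 * m) (4 * m) (4 * m) * norm4 1 0 0 0 ^+ 2 *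
   (klein_det 1 0 0 0 * norm4 1 0 0 0 ^+ 2) by rewrite /klein_det /norm4; ring.
by apply: det_repI; apply: compatP; lia.
Qed.

Lemma det_rep_18 m : det_rep (2 ^+ 18 * m).
Proof.
(* The first K is 256 (w + 1), the second -64 or 64. As d2 = d2' = 0, c2 = 2 w must agree with c2'
   modulo 4, which depends on the parity of m. *)
have [om|em] := boolP (oddz m); last first.
  pose w := - m - 1.
  have -> : 2 ^+ 18 * m = klein_det (2 * w + 5) (- 3 - 2 * w) (2 * w) (- (2 * w)) * norm4 1 1 0 0 ^+ 2 *
     (klein_det 1 1 2 (- 2) * norm4 1 1 0 0 ^+ 2) by rewrite /w /klein_det /norm4; ring.
  by move: em; rewrite /oddz => em; apply: det_rep_two_odd; rewrite /w /oddz;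
     [split; lia | split; lia | apply: compatP; lia | apply: compatP; lia].
pose w := m - 1.
have -> : 2 ^+ 18 * m = klein_det (2 * w + 5) (- 3 - 2 * w) (2 * w) (- (2 * w)) * norm4 1 1 0 0 ^+ 2 *
   (klein_det 3 (- 1) 0 0 * norm4 1 1 0 0 ^+ 2) by rewrite /w /klein_det /norm4; ring.
by move: om; rewrite /oddz => om; apply: det_rep_two_odd; rewrite /w /oddz;
   [split; lia | split; lia | apply: compatP; lia | apply: compatP; lia].
Qed.

Lemma det_rep_16_1mod4 k : det_rep (2 ^+ 16 * (4 * k + 1)).
Proof.
have -> : 2 ^+ 16 * (4 * k + 1) = klein_det (3 + 4 * k) (- 1 - 4 * k) (4 * k) (- (4 * k)) *
  norm4 1 1 0 0 ^+ 2 * (klein_det 3 (- 1) 0 0 * norm4 1 1 0 0 ^+ 2).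
  by rewrite /klein_det /norm4; ring.
by apply: det_rep_two_odd; rewrite /oddz;
   [split; lia | split; lia | apply: compatP; lia | apply: compatP; lia].
Qed.

Lemma det_rep_16_pm3 k j : det_rep (2 ^+ 16 * (4 * j + 3) * (8 * k - 3)).
Proof.
(* The first K is 64 (4 z + 1)(2 w + 1), and the second is -64. *)
pose z := 2 * k - 1; pose w := - 2 * j - 2.
have -> : 2 ^+ 16 * (4 * j + 3) * (8 * k - 3) =
  klein_det (2 * z + 1 + 2 * (w + 1)) (2 * z + 1 - 2 * (w + 1)) (2 * z + 2 * w) (2 * z - 2 * w) *
  norm4 1 1 0 0 ^+ 2 * (klein_det 1 1 2 (- 2) * norm4 1 1 0 0 ^+ 2).
  by rewrite /z /w /klein_det /norm4; ring.
by apply: det_rep_two_odd; rewrite /z /w /oddz;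
   [split; lia | split; lia | apply: compatP; lia | apply: compatP; lia].
Qed.

(** Here c2 and c3 are 0 while c2' and c3' are 2 modulo 4, so d2, d2' and d3, d3' must differ by 2
    modulo 4. *)
Lemma det_rep_16_sqr t l1 l2 d0 d1 d2 d3 d0' d1' d2' d3' :
  oddz d0 -> oddz d1 -> oddz d0' -> oddz d1' -> (2 %| d2)%Z -> (2 %| d3)%Z ->
  (4 %| d2 - d2' - 2)%Z -> (4 %| d3 - d3' - 2)%Z ->
  2 * l1 = norm4 d0 d1 d2 d3 -> 2 * l2 = norm4 d0' d1' d2' d3' ->
  det_rep (2 ^+ 16 * (8 * t - 1) * (l1 * l2) ^+ 2).
Proof.
move=> o0 o1 o0' o1' e2 e3 d22 d33 E1 E2; pose k := - 2 * t.
have -> : 2 ^+ 16 * (8 * t - 1) * (l1 * l2) ^+ 2 =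
   klein_det (3 + 4 * k) (- 1 - 4 * k) (4 * k) (- (4 * k)) * norm4 d0 d1 d2 d3 ^+ 2 *
  (klein_det 1 1 2 (- 2) * norm4 d0' d1' d2' d3' ^+ 2).
  by rewrite -E1 -E2 /k /klein_det; ring.
clear E1 E2; move: o0 o1 o0' o1'; rewrite /oddz /k => *; apply: det_rep_two_odd; rewrite /oddz;
   [split; lia | split; lia | apply: compatP; lia | apply: compatP; lia].
Qed.

Lemma det_rep_17 m l d0 d1 d2 d3 :
  oddz d0 -> oddz d1 -> (4 %| d2 - 2)%Z -> (4 %| d3)%Z -> 2 * l = norm4 d0 d1 d2 d3 ->
  det_rep (2 ^+ 17 * (2 * m + 1) * l ^+ 2).
Proof.
move=> o0 o1 e2 e3 E1.
have main x y u w : (x ^+ 2 - y ^+ 2) * (u ^+ 2 - w ^+ 2) = 8 * (2 * m + 1) ->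
    oddz x -> ~~ oddz u -> (4 %| y - w)%Z -> oddz y -> det_rep (2 ^+ 17 * (2 * m + 1) * l ^+ 2).
  move=> E ox eu yw oy.
  have -> : 2 ^+ 17 * (2 * m + 1) * l ^+ 2 = klein_det 3 (- 1) 0 0 * norm4 d0 d1 d2 d3 ^+ 2 *
    (klein_det (x + u) (x - u) (y + w) (y - w) * norm4 1 1 0 0 ^+ 2).
    have -> : klein_det (x + u) (x - u) (y + w) (y - w) = 16 * (8 * (2 * m + 1)).
      by rewrite -E /klein_det; ring.
    by rewrite -E1 /klein_det /norm4; ring.
  clear E E1; move: o0 o1 ox eu oy; rewrite /oddz => *; apply: det_rep_two_odd; rewrite /oddz;
   [split; lia | split; lia | apply: compatP; lia | apply: compatP; lia].
(* Taking x^2 - y^2 = 8 or -8 leaves u^2 - w^2 with consecutive u and w; the sign is chosen by the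
   class modulo 8 so that y - w is divisible by 4. *)
have : [\/ (exists j, 2 * m + 1 = - (8 * j + 1)), exists j, 2 * m + 1 = 8 * j + 3,
  exists j, 2 * m + 1 = 8 * j + 5 | exists j, 2 * m + 1 = - (8 * j + 7)].
  have : exists j r, m = 4 * j + r /\ [\/ r = 0, r = 1, r = 2 | r = 3].
    exists (m %/ 4)%Z, (m %% 4)%Z; split; first by lia.
    have : [|| (m %% 4)%Z == 0, (m %% 4)%Z == 1, (m %% 4)%Z == 2 | (m %% 4)%Z == 3] by lia.
    by case/or4P=> /eqP ->; [constructor 1 | constructor 2 | constructor 3 | constructor 4].
  case=> j [r [-> []->]]; [constructor 4; exists (- j - 1) | constructor 2; exists j
   | constructor 3; exists j | constructor 1; exists (- j - 1)]; ring.
case=> -[j Ej].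
- by apply: (main 3 1 (4 * j) (4 * j + 1)); rewrite ?Ej; [ring | rewrite /oddz; lia..].
- by apply: (main 3 1 (4 * j + 2) (4 * j + 1)); rewrite ?Ej; [ring | rewrite /oddz; lia..].
- by apply: (main 1 3 (4 * j + 2) (4 * j + 3)); rewrite ?Ej; [ring | rewrite /oddz; lia..].
- by apply: (main 1 3 (4 * j + 4) (4 * j + 3)); rewrite ?Ej; [ring | rewrite /oddz; lia..].
Qed.

(** * The determinants and the listed values coincide *)

Lemma det_rep_forms (n : int) : det_rep n -> oddz n /\ odd_form n \/ even_form n.
Proof.
case/det_rep_sorted=> u [v [w [t [[[cu cv cw ct] ->] [vu wv tw]]]]].
have [ou|eu] := boolP (oddz u.1.1); last first.
  have ev : ~~ oddz v.1.1 by apply: contra eu.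
  have ew : ~~ oddz w.1.1 by apply: contra ev.
  by right; apply: even_form_all_even => //; apply: contra ew.
have [ov|ev] := boolP (oddz v.1.1); last first.
  have ew : ~~ oddz w.1.1 by apply: contra ev.
  have et : ~~ oddz t.1.1 by apply: contra ew.
  have [m ->] := coord_det_one_odd cu cv cw ct ou ev ew et.
  by left; split; [rewrite /oddz; lia | left; lia].
have [ow|ew] := boolP (oddz w.1.1); last first.
  by right; apply: even_form_two_odd => //; apply: contra ew.
have [ot|et] := boolP (oddz t.1.1); first by right; apply: even_form_all_odd.
by left; apply: odd_form_three_odd.
Qed.

Lemma even_form_even n : even_form n -> ~~ oddz n.
Proof.
have e16 k : ~~ oddz (2 ^+ 16 * k) by rewrite exprS -mulrA /oddz; lia.
case=> [[m ->]|[m [p [_ _ ->]]]|[m [_ ->]]|[m [_ -> _]]] //.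
- by rewrite (_ : 2 ^+ 18 * m = 2 ^+ 16 * (4 * m)) //; ring.
- by rewrite (_ : _ * _ = 2 ^+ 16 * (2 * (2 * m + 1) * p%:Z ^+ 2)) //; ring.
Qed.

Lemma odd_form_det_rep n : odd_form n -> det_rep n.
Proof.
case=> [n1|[_ [s1 [s2 [l1 [l2 [_ [s13 s23] [l13 l23] rel ->]]]]]]].
  by rewrite (_ : n = 1 + 16 * (n %/ 16)%Z); [exact: det_rep_1mod16 | lia].
have [e1 [x1 [y1 [z1 E1]]]] := norm4_3mod4 l13; have [e2 [x2 [y2 [z2 E2]]]] := norm4_3mod4 l23.
have [a1 A1] : exists a, s1 = - (8 * a + 3) by exists ((- s1 - 3) %/ 8)%Z; lia.
have [a2 A2] : exists a, s2 = - (8 * a + 3) by exists ((- s2 - 3) %/ 8)%Z; lia.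
(* The linear forms are 8 a + 3 and three times -1. By [N8] below, the parity of e is that of (l -
   3)/4. *)
have K (a : int) : klein_det (2 * a) (2 * a + 1) (2 * a + 1) (2 * a + 1) = - (8 * a + 3).
  by rewrite /klein_det; ring.
have N8 (e x y z : int) : exists E,
    norm4 (2 * e) (4 * x + 1) (4 * y + 1) (4 * z + 1) = 3 + 4 * e + 8 * E.
  have [t Et] := sqr_even_mod8 e.
  exists (t + 2 * x ^+ 2 + x + 2 * y ^+ 2 + y + 2 * z ^+ 2 + z).
  by rewrite /norm4 Et; ring.
have [F1 M1] := N8 e1 x1 y1 z1; have [F2 M2] := N8 e2 x2 y2 z2.
have -> : s1 * s2 * (l1%:Z * l2%:Z) ^+ 2 = s1 * l1%:Z ^+ 2 * (s2 * l2%:Z ^+ 2) by ring.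
rewrite -E1 in M1; rewrite -E2 in M2; case: rel => -[s12 l12].
  rewrite A1 A2 -!K E1 E2; clear E1 E2; apply: det_repI; apply: compatP; lia.
(* Now a1, a2 and e1, e2 both differ in parity; negating the odd coordinates of the second norm
   restores the congruences modulo 4. *)
have -> : l2%:Z = norm4 (2 * e2) (- (4 * x2 + 1)) (- (4 * y2 + 1)) (- (4 * z2 + 1)).
  by rewrite E2 /norm4 !sqrrN.
rewrite A1 A2 -!K E1; clear E1 E2; apply: det_repI; apply: compatP; lia.
Qed.

Lemma even_form_det_rep n : even_form n -> det_rep n.
Proof.
case=> [[m ->]|[m [p [_ p3 ->]]]|[m [m8 ->]]|[m [m7 E]]].
- exact: det_rep_18.
- have [d0 [d1 [d2 [d3 [o0 o1 h2 h3 Ed]]]]] := double_norm4_3mod4 p3.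
  exact: det_rep_17 o0 o1 h2 h3 Ed.
- have [m1|m3] : (m %% 4)%Z = 1 \/ (m %% 8)%Z = 3 by case: m8; lia.
    by rewrite (_ : m = 4 * (m %/ 4)%Z + 1); [exact: det_rep_16_1mod4 | lia].
  have -> : 2 ^+ 16 * m = 2 ^+ 16 * (4 * (- 1) + 3) * (8 * (- (m %/ 8)%Z) - 3).
    by rewrite -mulrA; congr (_ * _); lia.
  exact: det_rep_16_pm3.
case=> [[t [l [l_gt0 l1 l5 ->]]]|[t [k ->]]]; last first.
  have -> : 8 * t + 3 = 4 * (2 * t) + 3 by ring.
  exact: det_rep_16_pm3.
have l_gt1 : (1 < l)%N by apply: leq_trans l5.
(* The least prime factor p of l decides: for p = 3 modulo 4 both p and q serve as norms, for p = 1
   modulo 8 the special four squares are used, for p = 5 modulo 8 a factor p is split off. *)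
have p_pr := pdiv_prime l_gt1; have /dvdnP[q Eq] := pdiv_dvd l.
move: (pdiv l) p_pr Eq => p p_pr Eq; rewrite {}Eq in l1 l5 l_gt0 l_gt1 *.
have p_odd : odd p by move: l1; clear; case: (boolP (odd p)) => // ep; nia.
have [p3|p3] := eqVneq (p %% 4)%N 3%N.
  have q3 : (q %% 4 = 3)%N.
    move: l1; rewrite -modnMm p3; have := ltn_pmod q (isT : (0 < 4)%N).
    by case: (q %% 4)%N => [|[|[|[|]]]].
  have [d0 [d1 [d2 [d3 [o0 o1 h2 h3 Ed]]]]] := double_norm4_3mod4 p3.
  have [d0' [d1' [d2' [d3' [o0' o1' h2' h3' Ed']]]]] := double_norm4_3mod4 q3.
  have -> : (q * p)%N%:Z = p%:Z * q%:Z by rewrite PoszM mulrC.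
  (* The swap sets the residues (2, 0) against (0, 2) modulo 4. *)
  rewrite (_ : norm4 d0' d1' d2' d3' = norm4 d0' d1' d3' d2') in Ed'; last by rewrite /norm4; ring.
  by apply: det_rep_16_sqr o0 o1 o0' o1' _ _ _ _ Ed Ed'; move: h2 h3 h2' h3'; clear; lia.
have q_odd : odd q by move: l1; clear; case: (boolP (odd q)) => // eq; nia.
have [s Es] : exists s, q%:Z ^+ 2 = 1 + 8 * s.
  have [s Es] := sqr_oddz (q./2)%:Z; exists s; rewrite -Es; congr (_ ^+ 2).
  by move: q_odd; clear; lia.
have [p1|p1] := eqVneq (p %% 8)%N 1%N.
  have [d0 [d1 [d2 [d3 [o0 o1 h2 h3 Ed]]]]] := double_sum4_1220 (sum4_1220_prime p_pr p1).
  (* The factor q^2 = 1 + 8 s is absorbed into t, so that 2 = 1 + 1 serves as the second norm. *)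
  have -> : 2 ^+ 16 * (8 * t - 1) * (q * p)%N%:Z ^+ 2 =
    2 ^+ 16 * (8 * (t + s * (8 * t - 1)) - 1) * (p%:Z * 1) ^+ 2.
    rewrite PoszM exprMn Es; ring.
  by apply: (@det_rep_16_sqr _ _ _ d0 d1 d2 d3 1 1 0 0) => //; move: h2 h3; clear; lia.
have [k Ek] : exists k, p%:Z = 8 * k - 3.
  by exists ((p%:Z + 3) %/ 8)%Z; move: p_odd p1 p3; clear; lia.
have -> : 2 ^+ 16 * (8 * t - 1) * (q * p)%N%:Z ^+ 2 =
  2 ^+ 16 * (4 * (2 * (t * (8 * k - 3) + s * (8 * t - 1) * (8 * k - 3) - k)) + 3) * (8 * k - 3).
  by rewrite PoszM exprMn Es Ek; ring.
exact: det_rep_16_pm3.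
Qed.

Theorem theorem4p1 :
  (forall n : int, ~~ (2 %| n)%Z ->
     (is_group_det Z2Q8 n <->
        (n = 1 %[mod 16])%Z \/
        ((n = 9 %[mod 16])%Z /\
         exists (s1 s2 : int) (l1 l2 : nat),
           [/\ (0 < l1)%N /\ (0 < l2)%N,
               (s1 = -3 %[mod 8])%Z /\ (s2 = -3 %[mod 8])%Z,
               (l1 = 3 %[mod 4])%N /\ (l2 = 3 %[mod 4])%N,
               ((s1 = s2 %[mod 16])%Z /\ (l1 = l2 %[mod 8])%N) \/
               ((s1 = s2 + 8 %[mod 16])%Z /\ (l1 = l2 + 4 %[mod 8])%N)
             & n = s1 * s2 * (l1%:Z * l2%:Z) ^+ 2])))
  /\
  (forall n : int,
     ((2 %| n)%Z /\ is_group_det Z2Q8 n) <->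
     [\/ exists m : int, n = 2 ^+ 18 * m,
         exists (m : int) (p : nat),
           [/\ prime p, (p = 3 %[mod 4])%N
             & n = 2 ^+ 17 * (2 * m + 1) * p%:Z ^+ 2],
         exists m : int,
           [\/ (m = 1 %[mod 8])%Z, (m = 3 %[mod 8])%Z | (m = 5 %[mod 8])%Z]
           /\ n = 2 ^+ 16 * m
       | exists m : int,
           [/\ (m = 7 %[mod 8])%Z, n = 2 ^+ 16 * m
             & (exists (t : int) (l : nat),
                  [/\ (0 < l)%N, (l = 1 %[mod 4])%N, (5 <= l)%N
                    & n = 2 ^+ 16 * (8 * t - 1) * l%:Z ^+ 2])
               \/ (exists t k : int,
                     n = 2 ^+ 16 * (8 * t + 3) * (8 * k - 3))]]).
Proof.
split=> n.
  move=> n_odd; rewrite det_repP; split=> [/det_rep_forms[[_ //]|/even_form_even]|].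
    by rewrite /oddz n_odd.
  exact: odd_form_det_rep.
rewrite det_repP; split=> [[n_even /det_rep_forms[[]|//]]|n_form].
  by rewrite /oddz n_even.
split; last exact: even_form_det_rep.
by have := even_form_even n_form; rewrite /oddz negbK.
Qed.
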